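(* The function $\mathcal{N}(P,E)\mapsto\mathbf{M}_E(\mathcal{N})$ on ported unimodular oriented matroids satisfies: (1) If $e\in E$ is neither a loop nor a coloop of $\mathcal{N}$, and $E'=E\setminus e$ (the sequence $E$ with $e$ removed), then \[\mathbf{M}_E(\mathcal{N})=\epsilon(PE)\,\epsilon(PE')\big(g_e\mathbf{M}_{E'}(\mathcal{N}/e)+r_e\mathbf{M}_{E'}(\mathcal{N}\setminus e)\big).\] (2) If $\mathcal{N}_1(P_1,E_1)$ and $\mathcal{N}_2(P_2,E_2)$ have disjoint ground sets and $E=E_1\sqcup E_2$, then \[\mathbf{M}_E(\mathcal{N}_1\oplus\mathcal{N}_2)=\epsilon(P_1P_2E)\,\epsilon(P_1E_1)\,\epsilon(P_2E_2)\;\mathbf{M}_{E_1}(\mathcal{N}_1)\,\mathbf{M}_{E_2}(\mathcal{N}_2).\] (3) If $P=\emptyset$ and $\mathcal{B}(\mathcal{N})$ is the set of bases of $\mathcal{N}$, then $\mathbf{M}_E(\mathcal{N})=\epsilon(E)\sum_{B\in\mathcal{B}(\mathcal{N})}g_B\,r_{E\setminus B}$ (a multiple of $\mathbf{1}$).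
   Context: $K\subseteq\mathbb{R}$ is a field, extended by parameters $g_e,r_e$; $g_B=\prod_{e\in B}g_e$. For a finite set $S$, $\mathcal{E}(KS)$ is the exterior algebra over $KS$ with basis $S$; for a sequence $A$ of distinct elements, $\mathbf{A}$ is the product of their images in order. Set symbols denote sequences in an arbitrary order; $AB$ is concatenation; $\bar X$ is the complement in the ground set. An extensor with ground set $S$ is an element of $\mathcal{E}(KS)$ that is a scalar multiple of $\mathbf{1}$ or an exterior product of vectors; its Plücker coordinates are the alternating function $\mathbf{N}[A]$ with $\mathbf{N}=\sum_A\mathbf{N}[A]\mathbf{A}$. A nonzero extensor presents the oriented matroid with chirotope $B\mapsto\mathrm{sign}\,\mathbf{N}[B]$; it is unimodular if its Plücker coordinates lie in $\{0,\pm1\}$; each unimodular oriented matroid has exactly two unimodular presentations $\pm\mathbf{N}$. Contraction: $(\mathbf{N}/e)[B]=\mathbf{N}[Be]$, $\mathbf{N}/X=\mathbf{N}/x_k/\cdots/x_1$. A ground set orientation $\epsilon$ is an alternating function on finite sequences of ground set elements into $\{1,-1,0\}$, nonzero on sequences of distinct elements, $\epsilon(\emptyset)=1$; canonical dual $\mathbf{N}^\perp[X]=\mathbf{N}[\bar X]\epsilon(\bar X X)$. A ported extensor $\mathbf{N}(P,E)$ has ground set $P\sqcup E$; $P_\iota,P_\upsilon$ are disjoint copies of $P$; $\iota_g,\upsilon_r$ are the algebra homomorphisms induced by $\mathbf{e}\mapsto g_e\mathbf{e},\ \mathbf{p}\mapsto\mathbf{p}_\iota$ and $\mathbf{e}\mapsto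 r_e\mathbf{e},\ \mathbf{p}\mapsto\mathbf{p}_\upsilon$; $\mathbf{M}(\mathbf{N})=\iota_g(\mathbf{N})\upsilon_r(\mathbf{N}^\perp)$, and with $E$ a fixed sequence $\mathbf{M}_E(\mathbf{N})=\mathbf{M}(\mathbf{N})/E$. A ported unimodular oriented matroid $\mathcal{N}(P,E)$ is a unimodular oriented matroid on $P\sqcup E$ with distinguished port set $P$; minors $\mathcal{N}/e$, $\mathcal{N}\setminus e$ for $e\in E$ keep the ports $P$. Define $\mathbf{M}_E(\mathcal{N}):=\mathbf{M}_E(\mathbf{N})$ for either unimodular presentation $\pm\mathbf{N}$ of $\mathcal{N}$. *)

(* Defs.v *)
From HB Require Import structures.
From mathcomp Require Import all_boot all_order all_algebra.
From mathcomp Require classical_sets.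
From mathcomp Require Import reals.
From mathcomp Require Import ring.

Set Implicit Arguments.
Unset Strict Implicit.
Unset Printing Implicit Defensive.

Import Order.TTheory GRing.Theory Num.Theory.
Local Open Scope ring_scope.

(* Inversions with respect to the enumeration order of T; that order is only an
   internal device fixing a basis of the exterior algebra. *)
Fixpoint ninv (T : finType) (s : seq T) : nat :=
  if s is x :: s' then
    (count (fun y => enum_rank y < enum_rank x) s' + ninv s')%N
  else 0%N.

Definition alternating (T : eqType) (V : zmodType) (f : seq T -> V) : Prop :=
  (forall s, ~~ uniq s -> f s = 0) /\
  (forall s1 s2 x y, f (s1 ++ [:: x, y & s2]) = - f (s1 ++ [:: y, x & s2])).

(* The exterior algebra over F with basis T: coordinates are indexed by subsets,
   the coordinate at A belonging to the product of A in enumeration order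
   (mon_enum, sum_base). A ground set S is a subset of a finite universe T, and
   the exterior algebra on S is the subalgebra of ext F T generated by S. *)
Definition ext (F : fieldType) (T : finType) : Type := {ffun {set T} -> F}.

Lemma ninv_enum (T : finType) (A : {set T}) : ninv (enum A) = 0%N.
Proof.
have : pairwise (fun x y : T => enum_rank x <= enum_rank y)%N (enum A).
  have -> : enum A = filter (mem A) (enum T).
    by rewrite !enumT /enum_mem -enumT.
  apply: (subseq_pairwise (filter_subseq _ _)).
  case E: (enum T) => [//|x0 s']; rewrite -E.
  have rk i : (i < #|T|)%N -> enum_rank (nth x0 (enum T) i) = i :> nat.
    by move=> lti; rewrite -(enum_val_nth x0 (Ordinal lti)) enum_valK.
  apply/(pairwiseP x0) => i j; rewrite !inE -cardE => lti ltj lij.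
  by rewrite !rk // ltnW.
elim: (enum A) => //= x s IH /andP[xs /IH ->]; rewrite addn0.
apply/eqP; rewrite -leqn0 leqNgt -has_count -all_predC.
by apply: sub_all xs => y /=; rewrite -leqNgt.
Qed.

Lemma ninv_cat (T : finType) (s t : seq T) : ninv (s ++ t) =
  (ninv s + ninv t + \sum_(x <- s) count (fun y => enum_rank y < enum_rank x)%N t)%N.
Proof.
elim: s => [|x s IH] /=; first by rewrite big_nil addn0.
rewrite big_cons IH count_cat -!addnA; congr addn.
by rewrite addnCA; congr addn; rewrite addnCA.
Qed.

Section ExteriorAlgebra.
Variables (F : fieldType) (T : finType).
Local Notation E := (ext F T).

HB.instance Definition _ := GRing.Lmodule.copy E {ffun {set T} -> F^o}.

Definition coef (x : E) (A : {set T}) : F := (x : {ffun {set T} -> F}) A.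

Definition ebase (A : {set T}) : E := [ffun B => (B == A)%:R].

Definition cross (A B : {set T}) : nat :=
  (\sum_(a in A) \sum_(b in B) (enum_rank b < enum_rank a))%N.

Definition esgn (A B : {set T}) : F :=
  if [disjoint A & B] then (-1) ^+ cross A B else 0.

Definition emul (x y : E) : E :=
  \sum_A \sum_B (esgn A B * coef x A * coef y B) *: ebase (A :|: B).

Lemma extP (x y : E) : (forall A, coef x A = coef y A) <-> x = y.
Proof. by split=> [h|-> //]; apply/ffunP. Qed.

Lemma coefD x y A : coef (x + y) A = coef x A + coef y A.
Proof. by rewrite /coef ffunE. Qed.

Lemma coefZ a x A : coef (a *: x) A = a * coef x A.
Proof. by rewrite /coef ffunE. Qed.

Lemma coef0 A : coef 0 A = 0.
Proof. by rewrite /coef ffunE. Qed.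

Lemma coefN x A : coef (- x) A = - coef x A.
Proof. by rewrite /coef ffunE. Qed.

Lemma coef_sum I (r : seq I) P (f : I -> E) A :
  coef (\sum_(i <- r | P i) f i) A = \sum_(i <- r | P i) coef (f i) A.
Proof. by apply: (big_morph (coef^~ A)) => [x y|]; rewrite ?coefD ?coef0. Qed.

Lemma coef_base A B : coef (ebase A) B = (B == A)%:R.
Proof. by rewrite /coef ffunE. Qed.

Lemma sum_base x : x = \sum_A coef x A *: ebase A.
Proof.
apply/extP => B; rewrite coef_sum (bigD1 B) //= big1 ?addr0.
  by rewrite coefZ coef_base eqxx mulr1.
by move=> A /negbTE nAB; rewrite coefZ coef_base eq_sym nAB mulr0.
Qed.

Lemma coef_emul x y C : coef (emul x y) C =
  \sum_A \sum_B esgn A B * coef x A * coef y B * (C == A :|: B)%:R.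
Proof.
rewrite coef_sum; apply: eq_bigr => A _; rewrite coef_sum.
by apply: eq_bigr => B _; rewrite coefZ coef_base.
Qed.

Lemma sum_disjU (A B : {set T}) (f : T -> nat) : [disjoint A & B] ->
  (\sum_(a in A :|: B) f a = \sum_(a in A) f a + \sum_(a in B) f a)%N.
Proof.
by move=> AB; rewrite -bigU //; apply: eq_bigl => a; rewrite !inE.
Qed.

Lemma crossUl (A B D : {set T}) : [disjoint A & B] ->
  cross (A :|: B) D = (cross A D + cross B D)%N.
Proof. by move=> AB; rewrite /cross; exact: sum_disjU. Qed.

Lemma crossUr (A B D : {set T}) : [disjoint B & D] ->
  cross A (B :|: D) = (cross A B + cross A D)%N.
Proof.
by move=> BD; rewrite /cross -big_split /=; apply: eq_bigr => a _; exact: sum_disjU.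
Qed.

Lemma esgn_cocycle A B D :
  esgn A B * esgn (A :|: B) D = esgn B D * esgn A (B :|: D).
Proof.
have dl (X Y Z : {set T}) : [disjoint X :|: Y & Z] = [disjoint X & Z] && [disjoint Y & Z].
  by rewrite -!setI_eq0 setIUl setU_eq0.
have dr (X Y Z : {set T}) : [disjoint X & Y :|: Z] = [disjoint X & Y] && [disjoint X & Z].
  by rewrite -!setI_eq0 setIUr setU_eq0.
rewrite /esgn dl dr.
case AB: [disjoint A & B]; case BD: [disjoint B & D]; case AD: [disjoint A & D];
  rewrite ?mul0r ?mulr0 //= -!exprD crossUl // crossUr //.
by rewrite addnA [in RHS]addnC.
Qed.

Lemma emulA : associative emul.
Proof.
move=> x y z; apply/extP => C; rewrite !coef_emul.
transitivity (\sum_A \sum_B \sum_D esgn B D * esgn A (B :|: D) *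
    (coef x A * coef y B * coef z D) * (C == A :|: B :|: D)%:R).
  apply: eq_bigr => A _.
  transitivity (\sum_U \sum_B \sum_D esgn A U * coef x A * (C == A :|: U)%:R *
      (esgn B D * coef y B * coef z D * (U == B :|: D)%:R)).
    apply: eq_bigr => U _; rewrite coef_emul mulrAC mulr_sumr.
    by apply: eq_bigr => B _; rewrite mulr_sumr.
  rewrite exchange_big /=; apply: eq_bigr => B _.
  rewrite exchange_big /=; apply: eq_bigr => D _.
  rewrite (bigD1 (B :|: D)) //= big1 ?addr0; last first.
    by move=> U /negbTE ->; rewrite !mulr0.
  rewrite eqxx setUA mulr1; move: (_ == _)%:R => c; ring.
apply/esym.
transitivity (\sum_U \sum_D \sum_A \sum_B esgn U D * coef z D * (C == U :|: D)%:R *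
      (esgn A B * coef x A * coef y B * (U == A :|: B)%:R)).
  apply: eq_bigr => U _; apply: eq_bigr => D _; rewrite coef_emul.
  rewrite [esgn U D * _]mulrC -!mulrA mulr_suml; apply: eq_bigr => A _.
  rewrite mulr_suml; apply: eq_bigr => B _.
  move: (_ == _)%:R (_ == _)%:R => c d; ring.
rewrite exchange_big /=.
under eq_bigr => D _ do rewrite exchange_big /=.
rewrite exchange_big /=; apply: eq_bigr => A _.
under eq_bigr => D _ do rewrite exchange_big /=.
rewrite exchange_big /=; apply: eq_bigr => B _; apply: eq_bigr => D _.
rewrite (bigD1 (A :|: B)) //= big1 ?addr0; last first.
  by move=> U /negbTE ->; rewrite !mulr0.
by rewrite eqxx -esgn_cocycle mulr1; move: (_ == _)%:R => c; ring.
Qed.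

Lemma esgn0l A : esgn set0 A = 1.
Proof. by rewrite /esgn -setI_eq0 set0I eqxx /cross big_set0. Qed.

Lemma esgn0r A : esgn A set0 = 1.
Proof.
rewrite /esgn -setI_eq0 setI0 eqxx /cross big1 // => a _; exact: big_set0.
Qed.

Lemma emulDl : left_distributive emul +%R.
Proof.
move=> x y z; apply/extP => C; rewrite coefD !coef_emul -big_split /=.
apply: eq_bigr => A _; rewrite -big_split /=; apply: eq_bigr => B _.
by rewrite coefD; move: (_ == _)%:R => c; ring.
Qed.

Lemma emulDr : right_distributive emul +%R.
Proof.
move=> x y z; apply/extP => C; rewrite coefD !coef_emul -big_split /=.
apply: eq_bigr => A _; rewrite -big_split /=; apply: eq_bigr => B _.
by rewrite coefD; move: (_ == _)%:R => c; ring.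
Qed.

Lemma emulZl a x y : a *: emul x y = emul (a *: x) y.
Proof.
apply/extP => C; rewrite coefZ !coef_emul mulr_sumr.
apply: eq_bigr => A _; rewrite mulr_sumr; apply: eq_bigr => B _.
by rewrite coefZ; move: (_ == _)%:R => c; ring.
Qed.

Lemma emulZr a x y : a *: emul x y = emul x (a *: y).
Proof.
apply/extP => C; rewrite coefZ !coef_emul mulr_sumr.
apply: eq_bigr => A _; rewrite mulr_sumr; apply: eq_bigr => B _.
by rewrite coefZ; move: (_ == _)%:R => c; ring.
Qed.

Lemma emul_base A B : emul (ebase A) (ebase B) = esgn A B *: ebase (A :|: B).
Proof.
rewrite /emul (bigD1 A) //= [X in _ + X]big1 ?addr0; last first.
  move=> A' /negbTE nA; apply: big1 => B' _.
  by rewrite coef_base nA mulr0 mul0r scale0r.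
rewrite (bigD1 B) //= [X in _ + X]big1 ?addr0; last first.
  by move=> B' /negbTE nB; rewrite !coef_base nB mulr0 scale0r.
by rewrite !coef_base !eqxx !mulr1.
Qed.

Lemma emul1l : left_id (ebase set0) emul.
Proof.
move=> x; rewrite {2}[x]sum_base /emul (bigD1 set0) //= [X in _ + X]big1 ?addr0.
  by apply: eq_bigr => B _; rewrite esgn0l coef_base eqxx !mul1r set0U.
by move=> A /negbTE nA; apply: big1 => B _; rewrite coef_base nA mulr0 mul0r scale0r.
Qed.

Lemma emul1r : right_id (ebase set0) emul.
Proof.
move=> x; rewrite {2}[x]sum_base /emul; apply: eq_bigr => A _.
rewrite (bigD1 set0) //= big1 ?addr0.
  by rewrite esgn0r coef_base eqxx mul1r mulr1 setU0.
by move=> B /negbTE nB; rewrite coef_base nB mulr0 scale0r.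
Qed.

Lemma ebase_neq0 A : ebase A != 0.
Proof.
apply/eqP => /extP /(_ A) /eqP.
by rewrite coef_base eqxx coef0 oner_eq0.
Qed.

HB.instance Definition _ := GRing.Zmodule_isNzRing.Build E
  emulA emul1l emul1r emulDl emulDr (ebase_neq0 set0).
HB.instance Definition _ := GRing.Lmodule_isLalgebra.Build F E emulZl.
HB.instance Definition _ := GRing.Lalgebra_isAlgebra.Build F E emulZr.

Definition gen (t : T) : E := ebase [set t].

Definition mon (s : seq T) : E := \prod_(t <- s) gen t.

(* Pluecker coordinate at a sequence. By pluck_alternating and expandK it is the
   alternating function whose expansion is x. *)
Definition pluck (x : E) (s : seq T) : F :=
  if uniq s then (-1) ^+ ninv s * coef x [set t in s] else 0.

Definition expand (f : seq T -> F) : E :=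
  \sum_(A : {set T}) f (enum A) *: mon (enum A).

Lemma gen_sq t : gen t * gen t = 0.
Proof. by rewrite -[LHS]/(emul _ _) emul_base /esgn -setI_eq0 setIid -cards_eq0 cards1 scale0r. Qed.

Lemma mon_sort s : mon s = (if uniq s then (-1) ^+ ninv s else 0) *: ebase [set t in s].
Proof.
rewrite /mon; elim: s => [|t s IH] /=.
  rewrite big_nil scale1r; congr ebase; by apply/setP => x; rewrite !inE.
rewrite big_cons IH -scalerAr [_ * _]emul_base scalerA.
have -> : [set t] :|: [set t0 in s] = [set t0 in t :: s].
  by apply/setP => x; rewrite !inE.
case: ifP => us; rewrite ?andbF ?mul0r // andbT.
rewrite /esgn disjoints1 inE; case: ifP => ts; rewrite ?mulr0 //.
rewrite -exprD addnC /cross big_set1; congr (_ ^+ (_ + _) *: _).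
rewrite -sum1_count [RHS]big_mkcond /= (eq_bigl (mem s)) => [|x]; last by rewrite inE.
by rewrite -(big_uniq _ us) /=; apply: eq_bigr => y _; case: ifP.
Qed.

Lemma mon_enum (A : {set T}) : mon (enum A) = ebase A.
Proof. by rewrite mon_sort enum_uniq ninv_enum scale1r set_enum. Qed.

Lemma pluck_enum x (A : {set T}) : pluck x (enum A) = coef x A.
Proof. by rewrite /pluck enum_uniq ninv_enum mul1r set_enum. Qed.

Lemma expandK x : expand (pluck x) = x.
Proof.
rewrite {2}[x]sum_base; apply: eq_bigr => A _.
by rewrite pluck_enum mon_enum.
Qed.

Lemma coef_expand f A : coef (expand f) A = f (enum A).
Proof.
rewrite coef_sum (bigD1 A) //= big1 ?addr0 => [|B /negbTE nB];
  by rewrite coefZ mon_enum coef_base ?eqxx ?mulr1 // eq_sym nB mulr0.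
Qed.

Lemma gen_anti s t : gen s * gen t = - (gen t * gen s).
Proof.
have m2 a b : gen a * gen b = mon [:: a; b] by rewrite /mon big_cons big_seq1.
have [->|nst] := eqVneq s t; first by rewrite gen_sq oppr0.
rewrite !m2 !mon_sort /= !inE nst eq_sym nst /= !addn0 -scaleNr.
have -> : [set x in [:: t; s]] = [set x in [:: s; t]].
  by apply/setP => x; rewrite !inE orbC.
congr (_ *: _); case: ltngtP => [_|_|/val_inj/enum_rank_inj e]; rewrite ?opprK //.
by rewrite e eqxx in nst.
Qed.

Lemma pluck_alternating x : alternating (pluck x).
Proof.
split=> [s /negbTE ns | s1 s2 a b]; first by rewrite /pluck ns.
rewrite /pluck.
have e : perm_eq (s1 ++ [:: b, a & s2]) (s1 ++ [:: a, b & s2]).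
  by rewrite perm_cat2l (perm_catCA [:: b] [:: a]).
rewrite (perm_uniq e).
have -> : [set t in s1 ++ [:: b, a & s2]] = [set t in s1 ++ [:: a, b & s2]].
  by apply/setP=> t; rewrite !inE (perm_mem e).
case: ifP => us; last by rewrite oppr0.
rewrite -mulNr; congr (_ * _).
have nab : a != b.
  by move: us; rewrite cat_uniq => /and3P[_ _ /=]; rewrite inE negb_or => /andP[/andP[]].
rewrite !ninv_cat /=.
rewrite [X in _ = - _ ^+ (_ + X)](eq_bigr (fun x => (enum_rank a < enum_rank x) +
  ((enum_rank b < enum_rank x) + count (fun y => enum_rank y < enum_rank x) s2))%N); last first.
  by move=> c _ /=; rewrite addnCA.
move: (\sum_(_ <- _) _)%N (count _ s2) (count _ s2) (ninv s1) (ninv s2) => m n p q k.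
case: (ltngtP (enum_rank a) (enum_rank b)) => [ab|ba|/val_inj/enum_rank_inj/eqP];
  last by rewrite (negbTE nab).
- by rewrite !exprD expr0 expr1; ring.
- by rewrite !exprD expr0 expr1; ring.
Qed.

End ExteriorAlgebra.

Section InducedMorphism.
Variables (K L : fieldType) (phi : {rmorphism K -> L}) (T T' : finType).
Variable h : T -> ext L T'.

(* The algebra homomorphism sending each t to h t and scalars through phi; see
   induced_gen, induced1, inducedD, inducedZ, inducedM. *)
Definition induced (x : ext K T) : ext L T' :=
  \sum_(A : {set T}) phi (pluck x (enum A)) *: \prod_(t <- enum A) h t.

Lemma inducedE x : induced x =
  \sum_(A : {set T}) phi (coef x A) *: \prod_(t <- enum A) h t.
Proof. by apply: eq_bigr => A _; rewrite pluck_enum. Qed.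

Lemma inducedD x y : induced (x + y) = induced x + induced y.
Proof.
rewrite !inducedE -big_split; apply: eq_bigr => A _ /=.
by rewrite coefD rmorphD scalerDl.
Qed.

Lemma inducedZ a x : induced (a *: x) = phi a *: induced x.
Proof.
rewrite !inducedE scaler_sumr; apply: eq_bigr => A _.
by rewrite coefZ rmorphM scalerA.
Qed.

Lemma induced0 : induced 0 = 0.
Proof. by rewrite -[X in induced X](scale0r 0) inducedZ rmorph0 scale0r. Qed.

Lemma inducedN x : induced (- x) = - induced x.
Proof. by rewrite -scaleN1r inducedZ rmorphN1 scaleN1r. Qed.

Lemma induced_sum I (s : seq I) P (f : I -> ext K T) :
  induced (\sum_(i <- s | P i) f i) = \sum_(i <- s | P i) induced (f i).
Proof. exact: (big_morph _ inducedD induced0). Qed.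

Lemma induced_base A : induced (ebase K A) = \prod_(t <- enum A) h t.
Proof.
rewrite inducedE (bigD1 A) //= [X in _ + X]big1 ?addr0.
  by rewrite coef_base eqxx rmorph1 scale1r.
by move=> B /negbTE nB; rewrite coef_base nB rmorph0 scale0r.
Qed.

Hypothesis h_sq : forall t, h t * h t = 0.
Hypothesis h_anti : forall s t, h s * h t = - (h t * h s).

Lemma prod_mem0 t s : t \in s -> h t * \prod_(x <- s) h x = 0.
Proof.
elim: s => //= y s IH; rewrite inE big_cons mulrA.
have [<- _|_ /= /IH e] := eqVneq t y; first by rewrite h_sq mul0r.
by rewrite h_anti mulNr -mulrA e mulr0 oppr0.
Qed.

Lemma prod_comm t s : h t * \prod_(x <- s) h x =
  (-1) ^+ size s *: (\prod_(x <- s) h x * h t).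
Proof.
elim: s => [|y s IH]; first by rewrite big_nil mulr1 mul1r scale1r.
by rewrite big_cons mulrA h_anti mulNr -[h y * h t * _]mulrA IH -scalerAr -scaleNr /= exprS mulN1r mulrA.
Qed.

Lemma prod_sort s : \prod_(t <- s) h t =
  (if uniq s then (-1) ^+ ninv s else 0) *: \prod_(t <- enum [set t in s]) h t.
Proof.
elim: s => [|t s IH] /=.
  have -> : [set t in [::]] = set0 :> {set T} by apply/setP => x; rewrite !inE.
  by rewrite big_nil scale1r enum_set0 big_nil.
rewrite big_cons.
have [ts|nts] /= := boolP (t \in s); first by rewrite prod_mem0 ?scale0r.
rewrite IH; case: ifP => us; last by rewrite !scale0r mulr0.
rewrite -scalerAr.
set lo := fun y => (enum_rank y < enum_rank t)%N.
have [l1 [l2 [e1 e2 e3]]] : exists l1 l2, [/\ enum T = l1 ++ t :: l2, all lo l1 & all (predC lo) l2].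
  exists (take (enum_rank t) (enum T)), (drop (enum_rank t).+1 (enum T)).
  have lt : (enum_rank t < size (enum T))%N by rewrite -cardE.
  have rk i : (i < #|T|)%N -> enum_rank (nth t (enum T) i) = i :> nat.
    by move=> lti; rewrite -(enum_val_nth t (Ordinal lti)) enum_valK.
  have nt : nth t (enum T) (enum_rank t) = t by apply: nth_enum_rank.
  split.
  - by rewrite -{1}(cat_take_drop (enum_rank t) (enum T)) (drop_nth t lt) nt.
  - apply/(all_nthP t) => i; rewrite size_take lt => li.
    by rewrite nth_take // /lo rk // (ltn_trans li).
  - apply/(all_nthP t) => i; rewrite size_drop => li.
    have lti : ((enum_rank t).+1 + i < #|T|)%N by move: li; rewrite ltn_subRL -cardE.
    by rewrite nth_drop /= /lo -leqNgt rk // addSn ltnW // ltnS leq_addr.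
have eS (S : {set T}) : enum S = [seq x <- l1 | x \in S] ++ [seq x <- t :: l2 | x \in S].
  by rewrite -filter_cat -e1 !enumT /enum_mem.
have tl : t \notin l1 ++ l2.
  have := enum_uniq T; rewrite e1 cat_uniq /= => /and3P[_ /norP[nl1 _] /andP[nl2 _]].
  by rewrite mem_cat negb_or nl1 nl2.
have ef l : {subset l <= l1 ++ l2} ->
    [seq x <- l | x \in [set t0 in t :: s]] = [seq x <- l | x \in [set t0 in s]].
  move=> sl; apply: eq_in_filter => x /sl xl; rewrite !inE.
  by case: eqP => // ex; rewrite ex (negbTE tl) in xl.
rewrite !eS /= !inE eqxx (negbTE nts) /= !ef; last 2 first.
- by move=> x xl; rewrite mem_cat xl orbT.
- by move=> x xl; rewrite mem_cat xl.
rewrite !big_cat big_cons /= [h t * (_ * _)]mulrA prod_comm -scalerAl scalerA -exprD -mulrA.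
congr ((-1) ^+ _ *: _); rewrite addnC; congr addn.
have /permP <- : perm_eq (enum [set x in s]) s.
  by apply: uniq_perm (enum_uniq _) us _ => x; rewrite mem_enum inE.
rewrite eS /= inE (negbTE nts) count_cat size_filter !count_filter.
rewrite [X in (_ + X)%N](_ : _ = 0%N); last first.
  by apply/eqP; rewrite -leqn0 leqNgt -has_count -all_predC;
    apply: sub_all e3 => x /= /negbTE ->.
rewrite addn0; apply: eq_in_count => x xl /=.
by rewrite (allP e2 x xl).
Qed.

Lemma inducedM x y : induced (x * y) = induced x * induced y.
Proof.
have key (A B : {set T}) : \prod_(t <- enum A) h t * \prod_(t <- enum B) h t =
   phi (esgn K A B) *: \prod_(t <- enum (A :|: B)) h t.
  rewrite -big_cat (prod_sort (enum A ++ enum B)).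
  have -> : [set t in enum A ++ enum B] = A :|: B.
    by apply/setP => t; rewrite !inE mem_cat !mem_enum.
  congr (_ *: _); rewrite cat_uniq !enum_uniq andbT /= ninv_cat !ninv_enum !add0n.
  have -> : ~~ has [in enum A] (enum B) = [disjoint A & B].
    rewrite -disjoint_has disjoint_sym; congr (_ == 0%N).
    by apply: eq_card => t; rewrite !inE !mem_enum.
  rewrite /esgn; case: ifP => _; last by rewrite rmorph0.
  rewrite rmorphXn rmorphN1; congr (_ ^+ _).
  rewrite /cross big_enum /=; apply: eq_bigr => a _.
  rewrite -sum1_count big_mkcond big_enum /=.
  by apply: eq_bigr => c _; case: ifP.
rewrite [x * y]/(emul x y) /emul induced_sum [induced x]inducedE [induced y]inducedE.
rewrite mulr_suml; apply: eq_bigr => A _.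
rewrite induced_sum mulr_sumr; apply: eq_bigr => B _.
rewrite inducedZ induced_base -scalerAl -scalerAr key !scalerA !rmorphM /=.
by congr (_ *: _); ring.
Qed.

Lemma induced_gen t : induced (gen K t) = h t.
Proof. by rewrite induced_base enum_set1 big_seq1. Qed.

Lemma induced1 : induced 1 = 1.
Proof. by rewrite induced_base enum_set0 big_nil. Qed.

End InducedMorphism.

Section Extensors.
Variables (F : fieldType) (T : finType).
Implicit Types (N : ext F T) (S : {set T}).

Definition vector_over S (v : ext F T) : Prop :=
  exists a : T -> F, v = \sum_(t in S) a t *: gen F t.

Definition extensor S N : Prop :=
  (exists c : F, N = c *: 1) \/
  (exists vs : seq (ext F T),
     (forall v, v \in vs -> vector_over S v) /\ N = \prod_(v <- vs) v).

Definition unimodular N : Prop := forall B, pluck N B \in [:: 0; 1; -1].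

Definition contract N (e : T) : ext F T := expand (fun B => pluck N (rcons B e)).

(* For X = x_1 .. x_k this is N / x_k / .. / x_1. *)
Definition contract_seq N (X : seq T) : ext F T :=
  foldr (fun e N' => contract N' e) N X.

(* The complement is taken in the ground set S; its order is irrelevant, since
   Xbar occurs in both alternating factors. *)
Definition dual (eps : seq T -> int) S N : ext F T :=
  expand (fun X =>
    let Xbar := enum (S :\: [set x in X]) in
    if all (fun x => x \in S) X then pluck N Xbar * (eps (Xbar ++ X))%:~R else 0).

End Extensors.

(* One orientation of all sequences of the universe serves the ground sets of a
   matroid, its minors and its direct sums at once. *)
Definition ground_orientation (T : finType) (eps : seq T -> int) : Prop :=
  [/\ alternating eps, eps [::] = 1
    & forall s, uniq s -> eps s \in [:: 1; -1]].

(* Target ground set: two disjoint copies of T, of which only P_iota and P_upsilon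
   are used, and T itself, of which only E is used. *)
Definition ported (T : finType) : finType := (T + T + T)%type.
Definition p_iota (T : finType) (t : T) : ported T := inl (inl t).
Definition p_upsilon (T : finType) (t : T) : ported T := inl (inr t).
Definition elt (T : finType) (t : T) : ported T := inr t.

Section PortedExtensors.
Variables (K L : fieldType) (phi : {rmorphism K -> L}) (T : finType).
Variables (eps : seq T -> int) (g r : T -> L).

Definition iotag (P : seq T) (t : T) : ext L (ported T) :=
  if t \in P then gen L (p_iota t) else g t *: gen L (elt t).

Definition upsilonr (P : seq T) (t : T) : ext L (ported T) :=
  if t \in P then gen L (p_upsilon t) else r t *: gen L (elt t).

Lemma iotag_anti P s t : iotag P s * iotag P t = - (iotag P t * iotag P s).
Proof.
by rewrite /iotag; do 2 case: ifP => _; rewrite -?scalerAl -?scalerAr gen_anti;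
  rewrite ?scalerN // scalerA mulrC -scalerA.
Qed.

Lemma iotag_sq P t : iotag P t * iotag P t = 0.
Proof.
by rewrite /iotag; case: ifP => _; rewrite -?scalerAl -?scalerAr gen_sq ?scaler0.
Qed.

Lemma upsilonr_anti P s t :
  upsilonr P s * upsilonr P t = - (upsilonr P t * upsilonr P s).
Proof.
by rewrite /upsilonr; do 2 case: ifP => _; rewrite -?scalerAl -?scalerAr gen_anti;
  rewrite ?scalerN // scalerA mulrC -scalerA.
Qed.

Lemma upsilonr_sq P t : upsilonr P t * upsilonr P t = 0.
Proof.
by rewrite /upsilonr; case: ifP => _; rewrite -?scalerAl -?scalerAr gen_sq ?scaler0.
Qed.

Definition extensor_M (P E : seq T) (N : ext K T) : ext L (ported T) :=
  induced phi (iotag P) N *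
  induced phi (upsilonr P) (dual eps [set t in P ++ E] N).

Definition extensor_ME (P E : seq T) (N : ext K T) : ext L (ported T) :=
  contract_seq (extensor_M P E N) (map (@elt T) E).

End PortedExtensors.

(* An oriented matroid is represented by its ground set and either of its two
   chirotopes; everything below depends on the chirotope only up to sign. *)
Record omat (T : finType) : Type := OMat { ground : {set T}; chi : seq T -> int }.

Section OrientedMatroids.
Variable T : finType.
Implicit Types M : omat T.

(* The last clause is the Grassmann-Pluecker axiom for chirotopes: y_i and x_1
   are exchanged in (x_1 .. x_k) and (y_1 .. y_k). *)
Definition oriented_matroid M : Prop :=
  [/\ alternating (chi M) /\ (forall B, chi M B \in [:: 0; 1; -1]),
      exists k, forall B, chi M B != 0 -> size B = k /\ {subset B <= ground M},
      exists B, chi M B != 0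
    & forall x xs ys,
        (forall i, (i < size ys)%N ->
           0 <= chi M (nth x ys i :: xs) * chi M (set_nth x ys i x)) ->
        0 <= chi M (x :: xs) * chi M ys].

Definition bases M : {set {set T}} := [set B : {set T} | chi M (enum B) != 0].

Definition loop M (e : T) : bool := [forall B in bases M, e \notin B].
Definition coloop M (e : T) : bool := [forall B in bases M, e \in B].

(* A loop is contracted by deleting it, a coloop deleted by contracting it. *)
Definition om_contract M (e : T) : omat T :=
  OMat (ground M :\ e)
    (if loop M e then fun B => if e \in B then 0 else chi M B
     else fun B => chi M (rcons B e)).

Definition om_delete M (e : T) : omat T :=
  OMat (ground M :\ e)
    (if coloop M e then fun B => chi M (rcons B e)
     else fun B => if e \in B then 0 else chi M B).

(* Parity of the shuffle bringing the elements of S1 before those of S2. *)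
Fixpoint nshuffle (S1 S2 : {set T}) (s : seq T) : nat :=
  if s is x :: s' then
    ((x \in S2) * count (fun y => y \in S1) s' + nshuffle S1 S2 s')%N
  else 0%N.

Definition om_sum M1 M2 : omat T :=
  let S1 := ground M1 in let S2 := ground M2 in
  OMat (S1 :|: S2)
    (fun B => if all (fun x => x \in S1 :|: S2) B then
       (-1) ^+ nshuffle S1 S2 B *
       (chi M1 [seq x <- B | x \in S1] * chi M2 [seq x <- B | x \in S2])
     else 0).

End OrientedMatroids.

Section UnimodularOrientedMatroids.
Variables (R : realType) (PK : {pred R}) (K : subFieldType PK) (T : finType).
Implicit Types (N : ext K T) (M : omat T).

Definition presents N M : Prop :=
  [/\ extensor (ground M) N, N != 0
    & exists b : bool, forall B, sgz (val (pluck N B)) = (-1) ^+ b * chi M B].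

Definition unimodular_om M : Prop :=
  oriented_matroid M /\ exists N, presents N M /\ unimodular N.

Definition ported_uom M (P E : seq T) : Prop :=
  [/\ unimodular_om M, uniq (P ++ E) & ground M = [set t in P ++ E]].

(* The choice is immaterial: see ME_presentation. *)
Definition presentation M : ext K T :=
  classical_sets.xget 0 (fun N => presents N M /\ unimodular N).

Variables (L : fieldType) (phi : {rmorphism K -> L}).
Variables (eps : seq T -> int) (g r : T -> L).

Definition ME (P E : seq T) M : ext L (ported T) :=
  extensor_ME phi eps g r P E (presentation M).

Lemma presentation_pm N1 N2 M : presents N1 M -> unimodular N1 ->
  presents N2 M -> unimodular N2 -> N2 = N1 \/ N2 = - N1.
Proof.
move=> [_ _ [b1 h1]] u1 [_ _ [b2 h2]] u2.
have key B : pluck N2 B = (-1) ^+ b1 * (-1) ^+ b2 * pluck N1 B.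
  have sgv (x : K) : x \in [:: 0; 1; -1] -> x = (sgz (val x))%:~R.
    by rewrite !inE => /or3P[]/eqP->; rewrite ?rmorph0 ?rmorphN ?rmorph1 ?sgz0 ?sgzN ?sgz1.
  rewrite [LHS]sgv // [pluck N1 B]sgv // h1 h2 !rmorphM !rmorphXn !rmorphN1.
  by rewrite mulrACA -expr2 sqrr_sign; ring.
have e : N2 = ((-1) ^+ b1 * (-1) ^+ b2) *: N1.
  by apply/extP => A; rewrite coefZ -!pluck_enum key.
rewrite e; case: b1 {h1 key e}; case: b2 {h2};
  by rewrite ?expr0 ?expr1 ?mulrNN ?mulr1 ?mul1r ?scaleN1r ?scale1r; auto.
Qed.

Lemma pluckN N B : pluck (- N) B = - pluck N B.
Proof. by rewrite /pluck coefN mulrN; case: ifP; rewrite ?oppr0. Qed.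

Lemma extensor_MEN P E N :
  extensor_ME phi eps g r P E (- N) = extensor_ME phi eps g r P E N.
Proof.
rewrite /extensor_ME /extensor_M; congr contract_seq.
have -> : dual eps [set t in P ++ E] (- N) = - dual eps [set t in P ++ E] N.
  apply/extP => A; rewrite coefN !coef_expand /=; case: ifP => _; rewrite ?oppr0 //.
  by rewrite pluckN mulNr.
by rewrite !inducedN mulrNN.
Qed.

Lemma ME_presentation P E M N : presents N M -> unimodular N ->
  ME P E M = extensor_ME phi eps g r P E N.
Proof.
move=> pN uN; rewrite /ME /presentation.
case: classical_sets.xgetP => [N' _ [pN' uN']|/(_ N)/=[]//].
by have [->|->] := presentation_pm pN uN pN' uN'; rewrite ?extensor_MEN.
Qed.

End UnimodularOrientedMatroids.

(* Main.v *)
(** Decompose N along a partition of the ground set into S1 and S2: for homogeneous x over S1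
    and y over S2, the dual of x y is, up to an explicit sign, the product of the duals of x
    and y.  Hence M(x y) is M(x) M(y) up to sign, and all signs cancel once M_E is multiplied
    by eps(P E), which also makes it independent of the order of E.  This is (2).
    For (1), write N = (N/e) e + (N\e) 1 and apply the product rule to both summands with
    S2 = {e}: the dual of e is 1 and that of 1 is e up to eps(e), so the second factors
    contribute g_e and r_e.  Of the two cross terms in M(N), one contains e twice and the
    other does not contain e, so both are killed by the contraction.
    For (3), expand N and its dual in monomials: without ports only the products of A with the
    complement of A survive the contraction of E. *)

From mathcomp Require Import all_boot all_order all_algebra.
From mathcomp Require Import reals.
From mathcomp Require Import ring.
Require Import Defs.

Set Implicit Arguments.
Unset Strict Implicit.
Unset Printing Implicit Defensive.

Import Order.TTheory GRing.Theory Num.Theory.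
Local Open Scope ring_scope.

(** * Alternating functions and supports *)

Section Alternating.
Variable T : eqType.

(** Adjacent transpositions generate all permutations: [front] carries one letter to the left step
    by step, and the prefix [p] collects the letters already in place. *)
Lemma perm_adjacent (Q : seq T -> Prop) :
  (forall s1 s2 x y, Q (s1 ++ [:: x, y & s2]) -> Q (s1 ++ [:: y, x & s2])) ->
  forall s t, perm_eq s t -> Q s -> Q t.
Proof.
move=> swap.
have front y : forall s1 p s2, Q (p ++ s1 ++ y :: s2) -> Q (p ++ y :: s1 ++ s2).
  elim=> //= x s1 IH p s2; rewrite -cat_rcons => /IH; rewrite cat_rcons; exact: swap.
suff gen t : forall s p, perm_eq s t -> Q (p ++ s) -> Q (p ++ t).
  by move=> s t; exact: (gen t s [::]).
elim: t => [|y t IH] s p st; first by move/perm_nilP: st => ->.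
have ys : y \in s by rewrite (perm_mem st) mem_head.
case/splitPr: ys st => s1 s2; rewrite -cat1s perm_catCA /= perm_cons => st.
by move/front; rewrite -!cat_rcons; exact: IH.
Qed.

(** Each adjacent swap flips both signs. This makes every expression in which an arbitrary order
    occurs in two alternating factors independent of that order. *)
Lemma alternatingM (V : comNzRingType) (f h : seq T -> V) s t :
  alternating f -> alternating h -> perm_eq s t -> f s * h s = f t * h t.
Proof.
move=> [_ f2] [_ h2] st.
apply: (perm_adjacent (Q := fun u => f s * h s = f u * h u)) st erefl.
by move=> s1 s2 x y ->; rewrite f2 h2 mulrNN.
Qed.

(** An alternating function is determined on all orders of a set by its value on one of them, so an
    identity may be checked on the most convenient order. *)
Lemma alternating_eq (V : zmodType) (f h : seq T -> V) s t :
  alternating f -> alternating h -> perm_eq s t -> f s = h s -> f t = h t.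
Proof.
move=> [_ f2] [_ h2] st; apply: (perm_adjacent (Q := fun u => f u = h u)) st.
by move=> s1 s2 x y e; rewrite f2 h2 -e f2 opprK.
Qed.

Lemma alternating_cat (V : zmodType) (f : seq T -> V) p q :
  alternating f -> alternating (fun s => f (p ++ s ++ q)).
Proof.
move=> [f1 f2]; split=> [s ns|s1 s2 x y].
  by apply: f1; rewrite !cat_uniq (negbTE ns) /= !andbF.
by rewrite -!catA /= !(catA p) f2.
Qed.

Lemma alternating_intr (V : nzRingType) (f : seq T -> int) :
  alternating f -> alternating (fun s => (f s)%:~R : V).
Proof. by move=> [f1 f2]; split=> [s /f1 -> //|s1 s2 x y]; rewrite f2 rmorphN. Qed.

(** Every letter of [b] crosses every letter of [c] once; [one] is the case of a single letter. *)
Lemma alternating_swap (V : nzRingType) (f : seq T -> V) a b c d :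
  alternating f ->
  f (a ++ b ++ c ++ d) = (-1) ^+ (size b * size c) * f (a ++ c ++ b ++ d).
Proof.
move=> [_ f2].
have one x : forall c a d, f (a ++ x :: c ++ d) = (-1) ^+ size c * f (a ++ c ++ x :: d).
  elim=> [|y c' IH] a' d' /=; first by rewrite mul1r.
  by rewrite f2 -cat_rcons IH cat_rcons exprS mulN1r mulNr.
elim: b a => [|x b IH] a /=; first by rewrite mul0n mul1r.
rewrite -cat_rcons IH cat_rcons one mulrA -exprD; congr (_ ^+ _ * _).
by rewrite mulSn addnC.
Qed.

End Alternating.

(** * Supports, degrees and coordinates of products *)

Section Support.
Variables (F : fieldType) (T : finType).
Implicit Types (x y : ext F T) (S A B : {set T}).

(** All elements live in the algebra on the whole universe, so ground set and degree are carried as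
    predicates. Zero is over every set and homogeneous of every degree. *)
Definition over S x := forall A, ~~ (A \subset S) -> coef x A = 0.
Definition homog (k : nat) x := forall A, #|A| != k -> coef x A = 0.

Lemma over_pluck S x (s : seq T) : over S x -> ~~ ([set t in s] \subset S) -> pluck x s = 0.
Proof. by move=> ox ns; rewrite /pluck ox // mulr0 if_same. Qed.

Lemma homog_pluck k x s : homog k x -> size s != k -> pluck x s = 0.
Proof.
move=> hx ns; rewrite /pluck; case: ifP => // us; rewrite hx ?mulr0 //.
by rewrite cardsE (card_uniqP us).
Qed.

Lemma over_sub S S' x : S \subset S' -> over S x -> over S' x.
Proof. by move=> SS ox A nA; apply: ox; apply: contra nA => /subset_trans; exact. Qed.

Lemma over0 S : over S 0. Proof. by move=> A _; rewrite coef0. Qed.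
Lemma overD S x y : over S x -> over S y -> over S (x + y).
Proof. by move=> ox oy A nA; rewrite coefD ox ?oy ?addr0. Qed.
Lemma overZ S a x : over S x -> over S (a *: x).
Proof. by move=> ox A nA; rewrite coefZ ox ?mulr0. Qed.
Lemma over_sum S I (s : seq I) (P : pred I) (f : I -> ext F T) :
  (forall i, P i -> over S (f i)) -> over S (\sum_(i <- s | P i) f i).
Proof. by move=> h; apply: (big_ind (over S)) => //; [exact: over0|exact: overD]. Qed.
Lemma over_base S A : A \subset S -> over S (ebase F A).
Proof. by move=> AS B; rewrite coef_base; case: eqP => // ->; rewrite AS. Qed.
Lemma over_gen S t : t \in S -> over S (gen F t).
Proof. by move=> tS; apply: over_base; rewrite sub1set. Qed.
Lemma over1 S : over S 1. Proof. by apply: over_base; exact: sub0set. Qed.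

Lemma overM S x y : over S x -> over S y -> over S (x * y).
Proof.
move=> ox oy C nC; rewrite [x * y]/(emul x y) coef_emul big1 // => A _; rewrite big1 // => B _.
case: (C =P A :|: B) => [e|]; last by rewrite mulr0.
move: nC; rewrite e subUset negb_and => /orP[/ox ->|/oy ->]; by rewrite ?(mulr0, mul0r).
Qed.

Lemma over_prod S I (s : seq I) (P : pred I) (f : I -> ext F T) :
  (forall i, P i -> over S (f i)) -> over S (\prod_(i <- s | P i) f i).
Proof. by move=> h; apply: (big_ind (over S)) => //; [exact: over1|exact: overM]. Qed.

Lemma homog0 k : homog k 0. Proof. by move=> A _; rewrite coef0. Qed.
Lemma homogD k x y : homog k x -> homog k y -> homog k (x + y).
Proof. by move=> ox oy A nA; rewrite coefD ox ?oy ?addr0. Qed.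
Lemma homogZ k a x : homog k x -> homog k (a *: x).
Proof. by move=> ox A nA; rewrite coefZ ox ?mulr0. Qed.
Lemma homog_sum k I (s : seq I) (P : pred I) (f : I -> ext F T) :
  (forall i, P i -> homog k (f i)) -> homog k (\sum_(i <- s | P i) f i).
Proof. by move=> h; apply: (big_ind (homog k)) => //; [exact: homog0|exact: homogD]. Qed.
Lemma homog_base A : homog #|A| (ebase F A).
Proof. by move=> B; rewrite coef_base; case: (B =P A) => // ->; rewrite eqxx. Qed.
Lemma homog1 : homog 0 (1 : ext F T).
Proof. by have := @homog_base set0; rewrite cards0. Qed.
Lemma homog_gen t : homog 1 (gen F t).
Proof. by have := @homog_base [set t]; rewrite cards1. Qed.

Lemma homogM k l x y : homog k x -> homog l y -> homog (k + l) (x * y).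
Proof.
move=> hx hy C nC; rewrite [x * y]/(emul x y) coef_emul big1 // => A _; rewrite big1 // => B _.
case: (C =P A :|: B) => [e|]; last by rewrite mulr0.
rewrite /esgn; case: ifP => [dAB|]; last by rewrite !mul0r.
have [kA|/hx ->] := eqVneq #|A| k; last by rewrite mulr0 !mul0r.
have [lB|/hy ->] := eqVneq #|B| l; last by rewrite mulr0 !mul0r.
by rewrite e cardsU disjoint_setI0 // cards0 subn0 kA lB eqxx in nC.
Qed.

Lemma homog_prod (s : seq (ext F T)) :
  (forall v, v \in s -> homog 1 v) -> homog (size s) (\prod_(v <- s) v).
Proof.
elim: s => [|v s IH] h; first by rewrite big_nil; exact: homog1.
rewrite big_cons -[size _]/(1 + size s)%N; apply: homogM; first by apply: h; rewrite mem_head.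
by apply: IH => w ws; apply: h; rewrite inE ws orbT.
Qed.

Lemma pluck_perm x (f : seq T -> F) (s : seq T) :
  alternating f -> f (enum [set t in s]) = pluck x (enum [set t in s]) -> f s = pluck x s.
Proof.
move=> altf e; have [us|ns] := boolP (uniq s); last first.
  by rewrite (proj1 altf) // /pluck (negbTE ns).
apply: alternating_eq e => //; first exact: pluck_alternating.
by apply: uniq_perm (enum_uniq _) us _ => t; rewrite mem_enum inE.
Qed.

(** Together with [expandK] this identifies elements of the exterior algebra with alternating
    functions. Both sides alternate, and they agree on enumerations. *)
Lemma pluck_expand (f : seq T -> F) s : alternating f -> pluck (expand f) s = f s.
Proof. by move=> af; apply/esym/pluck_perm => //; rewrite pluck_enum coef_expand. Qed.

(** The union of the letters of [s] and [t] splits in only one way into a part in [S1] and a part in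
    [S2], so a single term of the product contributes. *)
Lemma pluck_mul S1 S2 x y (s t : seq T) : [disjoint S1 & S2] -> over S1 x -> over S2 y ->
  {subset s <= S1} -> {subset t <= S2} -> pluck (x * y) (s ++ t) = pluck x s * pluck y t.
Proof.
move=> dS ox oy sS tS; rewrite /pluck cat_uniq.
have dst a : a \in t -> a \notin s.
  by move=> /tS aS2; apply/negP => /sS aS1; move/disjoint_setI0/setP/(_ a): dS; rewrite !inE aS1 aS2.
have -> : has [in s] t = false by apply/negbTE/hasPn.
case us: (uniq s); case ut: (uniq t); rewrite /= ?(mulr0, mul0r) //.
rewrite [x * y]/(emul x y) coef_emul.
have sA : [set z in s] \subset S1 by apply/subsetP => z; rewrite inE => /sS.
have tB : [set z in t] \subset S2 by apply/subsetP => z; rewrite inE => /tS.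
have cup : [set z in s ++ t] = [set z in s] :|: [set z in t].
  by apply/setP => z; rewrite !inE mem_cat.
have only A B : A \subset S1 -> B \subset S2 -> [set z in s ++ t] = A :|: B ->
    A = [set z in s] /\ B = [set z in t].
  have cut (U V X Y : {set T}) : [disjoint U & V] -> X \subset U -> Y \subset V ->
      (X :|: Y) :&: U = X.
    move=> dUV XU YV; rewrite setIUl (setIidPl XU).
    have /disjoint_setI0 -> : [disjoint Y & U].
      by rewrite disjoint_sym; apply: disjointWr dUV.
    by rewrite setU0.
  move=> AS BS e; split.
    by rewrite -(cut S1 S2 A B) // -e cup (cut S1 S2).
  have dS' : [disjoint S2 & S1] by rewrite disjoint_sym.
  by rewrite -(cut S2 S1 B A) // setUC -e cup setUC (cut S2 S1).
rewrite (bigD1 [set z in s]) //= [X in _ + X]big1 ?addr0; last first.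
  move=> A nA; apply: big1 => B _.
  have [AS|/ox ->] := boolP (A \subset S1); last by rewrite mulr0 !mul0r.
  have [BS|/oy ->] := boolP (B \subset S2); last by rewrite mulr0 !mul0r.
  case: (_ =P A :|: B) => [/(only A B AS BS) [eA _]|]; last by rewrite mulr0.
  by rewrite eA eqxx in nA.
rewrite (bigD1 [set z in t]) //= big1 ?addr0; last first.
  move=> B nB.
  have [BS|/oy ->] := boolP (B \subset S2); last by rewrite mulr0 !mul0r.
  case: (_ =P _ :|: B) => [/(only _ B sA BS) [_ eB]|]; last by rewrite mulr0.
  by rewrite eB eqxx in nB.
rewrite cup eqxx mulr1 /esgn.
have -> : [disjoint [set z in s] & [set z in t]].
  by apply: disjointWl sA _; apply: disjointWr tB _.
have -> : cross [set z in s] [set z in t] =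
    (\sum_(a <- s) count (fun b => enum_rank b < enum_rank a) t)%N.
  rewrite /cross (eq_bigl (mem s)) => [|a]; last by rewrite inE.
  rewrite -(big_uniq _ us) /=; apply: eq_bigr => a _.
  rewrite (eq_bigl (mem t)) => [|b]; last by rewrite inE.
  rewrite -(big_uniq _ ut) /= -sum1_count [RHS]big_mkcond /=.
  by apply: eq_bigr => b _; case: ifP.
(* The inversions between [s] and [t] occur twice, in the sorting sign of [s ++ t] and in [esgn], so
   their sign squares to 1. *)
rewrite ninv_cat; set c := (\sum_(_ <- _) _)%N.
rewrite !exprD.
have := sqrr_sign F c; rewrite expr2; move: ((-1) ^+ c) => z zz.
transitivity ((z * z) * ((-1) ^+ ninv s * (-1) ^+ ninv t * coef x [set z in s] * coef y [set z in t])).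
  by ring.
by rewrite zz; ring.
Qed.

(** Any subset of [S1 :|: S2] can be ordered with its [S1] part first, and alternation recovers the
    coordinate at its enumeration. *)
Lemma ext_split S1 S2 x y : [disjoint S1 & S2] ->
  over (S1 :|: S2) x -> over (S1 :|: S2) y ->
  (forall A B, A \subset S1 -> B \subset S2 ->
     pluck x (enum A ++ enum B) = pluck y (enum A ++ enum B)) -> x = y.
Proof.
move=> dS ox oy h; apply/extP => A.
have [AS|nA] := boolP (A \subset S1 :|: S2); last by rewrite ox ?oy.
rewrite -!pluck_enum.
apply: alternating_eq (h (A :&: S1) (A :&: S2) (subsetIr _ _) (subsetIr _ _)).
- exact: pluck_alternating.
- exact: pluck_alternating.
apply: uniq_perm; rewrite ?enum_uniq //.
  rewrite cat_uniq !enum_uniq andbT /=; apply/hasPn => a; rewrite !mem_enum !inE => /andP[_ a2].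
  by apply/negP => /andP[_ a1]; move/disjoint_setI0/setP/(_ a): dS; rewrite !inE a1 a2.
move=> a; rewrite mem_cat !mem_enum !inE -andb_orr.
by case aA: (a \in A) => //=; have := subsetP AS a aA; rewrite inE.
Qed.

End Support.

(** * Duals *)

Section Dual.
Variables (F : fieldType) (T : finType) (eps : seq T -> int).
Hypothesis eps_go : ground_orientation eps.
Implicit Types (x y : ext F T) (S : {set T}).

Lemma eps_sq s : uniq s -> eps s * eps s = 1.
Proof. by case: eps_go => _ _ h /h; rewrite !inE => /orP[]/eqP->. Qed.

(** Each of the two orders occurs in two alternating factors. This is why the sign in [dual_mul]
    depends on the two ground sets only and not on their orders. *)
Lemma eps_cat s1 s2 t1 t2 : perm_eq s1 t1 -> perm_eq s2 t2 ->
  eps (s1 ++ s2) * eps s1 * eps s2 = eps (t1 ++ t2) * eps t1 * eps t2.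
Proof.
case: eps_go => alt _ _ p1 p2.
have alt1 : alternating (fun s => eps (s ++ s2)) := alternating_cat [::] s2 alt.
have alt2 : alternating (fun s => eps (t1 ++ s)).
  by have := alternating_cat t1 [::] alt; case=> a b; split=> [s /a|s1' s2' x y];
    rewrite ?cats0 //; have := b s1' s2' x y; rewrite !cats0.
rewrite (alternatingM alt1 alt p1) mulrAC (alternatingM alt2 alt p2).
by rewrite mulrAC.
Qed.

(** The complement may be listed in any order [Y], since both factors alternate in it. Alternation
    in [X] comes from [eps] alone: a swap in [X] leaves the complement as it is. *)
Lemma pluck_dual S x (X Y : seq T) : uniq Y -> {subset X <= S} ->
  [set t in Y] = S :\: [set t in X] ->
  pluck (dual eps S x) X = pluck x Y * (eps (Y ++ X))%:~R.
Proof.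
case: eps_go => alt _ _ uY XS eY.
rewrite pluck_expand; last first.
  split=> [s ns|s1 s2 a b].
    rewrite /=; case: (all _ s) => //; rewrite (proj1 alt) ?mulr0 //.
    by rewrite cat_uniq (negbTE ns) !andbF.
  have e : perm_eq (s1 ++ [:: b, a & s2]) (s1 ++ [:: a, b & s2]).
    by rewrite perm_cat2l (perm_catCA [:: b] [:: a]).
  rewrite (perm_all _ e).
  have -> : [set t in s1 ++ [:: b, a & s2]] = [set t in s1 ++ [:: a, b & s2]].
    by apply/setP=> t; rewrite !inE (perm_mem e).
  rewrite /=; case: (all _ _); last by rewrite oppr0.
  by set Z := enum _; rewrite (catA Z) (proj2 alt) -catA rmorphN mulrN.
have -> : all (fun z => z \in S) X by apply/allP.
rewrite -eY.
have pe : perm_eq (enum [set t in Y]) Y.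
  by apply: uniq_perm (enum_uniq _) uY _ => t; rewrite mem_enum inE.
apply: (alternatingM (h := fun s => (eps (s ++ X))%:~R)) pe.
  exact: pluck_alternating.
by have := alternating_intr F (alternating_cat [::] X alt).
Qed.

Lemma over_dual S x : over S (dual eps S x).
Proof.
move=> A nA; rewrite coef_expand /=; case: ifP => // /allP h; case/negP: nA.
by apply/subsetP => a aA; apply: h; rewrite mem_enum.
Qed.

Lemma homog_dual S k x : homog k x -> homog (#|S| - k)%N (dual eps S x).
Proof.
move=> hx A nA; rewrite coef_expand /=; case: ifP => // /allP h.
have AS : A \subset S by apply/subsetP => a aA; apply: h; rewrite mem_enum.
rewrite set_enum (homog_pluck hx) ?mul0r // -cardE cardsD (setIidPr AS).
apply: contra nA => /eqP <-; rewrite subKn //; exact: subset_leq_card.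
Qed.

Lemma dualD S x y : dual eps S (x + y) = dual eps S x + dual eps S y.
Proof.
apply/extP => A; rewrite coefD !coef_expand /=; case: ifP => _; last by rewrite addr0.
by rewrite !pluck_enum coefD mulrDl.
Qed.

(** With [Y1], [Y2] the complements of [A], [B] in [S1], [S2], the dual of the product carries [eps]
    at [Y1 Y2 A B] and the duals of the factors carry it at [Y1 A] and [Y2 B]. Moving [A] across
    [Y2] gives the power of -1, and [eps_cat] replaces [Y1 A] and [Y2 B] by [z1] and [z2]. *)
Lemma dual_mul S1 S2 (z1 z2 : seq T) x y k l : [disjoint S1 & S2] ->
  uniq z1 -> uniq z2 -> S1 = [set t in z1] -> S2 = [set t in z2] ->
  over S1 x -> over S2 y -> homog k x -> homog l y ->
  dual eps (S1 :|: S2) (x * y) =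
  ((-1) ^+ (l * (#|S1| - k)) * (eps (z1 ++ z2) * eps z1 * eps z2)%:~R) *:
    (dual eps S1 x * dual eps S2 y).
Proof.
move=> dS u1 u2 e1 e2 ox oy hx hy; case: (eps_go) => alt _ _.
have oU : over (S1 :|: S2) (dual eps S1 x * dual eps S2 y).
  by apply: overM; [apply: (over_sub (subsetUl _ _))|apply: (over_sub (subsetUr _ _))];
    exact: over_dual.
apply: (ext_split dS); [exact: over_dual|exact: overZ|move=> A B AS BS].
have dA a : a \in S1 -> a \in S2 = false.
  by move=> a1; apply/negP => a2; move/disjoint_setI0/setP/(_ a): dS; rewrite !inE a1 a2.
have dB a : a \in S2 -> a \in S1 = false.
  by move=> a2; apply/negP => a1; rewrite (dA a a1) in a2.
set Y1 := enum (S1 :\: A); set Y2 := enum (S2 :\: B).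
have Y1S : {subset Y1 <= S1} by move=> a; rewrite mem_enum inE => /andP[].
have Y2S : {subset Y2 <= S2} by move=> a; rewrite mem_enum inE => /andP[].
have AS' : {subset enum A <= S1} by move=> a; rewrite mem_enum; exact: (subsetP AS).
have BS' : {subset enum B <= S2} by move=> a; rewrite mem_enum; exact: (subsetP BS).
rewrite (pluck_dual _ (Y := Y1 ++ Y2)); first last.
- apply/setP => a; rewrite !inE !mem_cat !mem_enum !inE.
  case a1: (a \in S1); first by rewrite (dA a a1) (contraFF (subsetP BS a) (dA a a1)) !andbF !orbF.
  by rewrite (contraFF (subsetP AS a) a1) andbF.
- by move=> a; rewrite mem_cat inE => /orP[/AS' ->|/BS' ->]; rewrite ?orbT.
- rewrite cat_uniq !enum_uniq andbT; apply/hasPn => a /Y2S /dB /negP a1.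
  by apply/negP => /Y1S.
rewrite (pluck_mul dS) //.
have -> : pluck (((-1) ^+ (l * (#|S1| - k)) * (eps (z1 ++ z2) * eps z1 * eps z2)%:~R) *:
    (dual eps S1 x * dual eps S2 y)) (enum A ++ enum B) =
  (-1) ^+ (l * (#|S1| - k)) * (eps (z1 ++ z2) * eps z1 * eps z2)%:~R *
  pluck (dual eps S1 x * dual eps S2 y) (enum A ++ enum B).
  by rewrite /pluck coefZ; case: ifP => _; [rewrite mulrCA|rewrite mulr0].
rewrite (pluck_mul dS) //; [|exact: over_dual|exact: over_dual].
rewrite (pluck_dual _ (Y := Y1)) ?enum_uniq //; last by rewrite !set_enum.
rewrite (pluck_dual _ (Y := Y2)) ?enum_uniq //; last by rewrite !set_enum.
(* Unless [Y1] and [Y2] have sizes [k] and [l], both sides vanish by homogeneity; so the sizes in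
   the sign may be assumed. *)
have [s1|n1] := eqVneq (size Y1) k; last by rewrite (homog_pluck hx n1) !mul0r mulr0.
have [s2|n2] := eqVneq (size Y2) l; last by rewrite (homog_pluck hy n2) ?(mul0r, mulr0).
have sA : size (enum A) = (#|S1| - k)%N.
  rewrite -s1 -!cardE cardsD (setIidPr AS) subKn //; exact: subset_leq_card.
rewrite -catA (alternating_swap Y1 _ _ _ alt) s2 sA catA.
have p1 : perm_eq z1 (Y1 ++ enum A).
  apply: uniq_perm => //.
    rewrite cat_uniq !enum_uniq andbT; apply/hasPn => a; rewrite !mem_enum => aA.
    by rewrite inE aA.
  move=> a; rewrite mem_cat !mem_enum !inE e1 inE.
  case aA: (a \in A) => /=; last by rewrite orbF.
  by have := subsetP AS a aA; rewrite e1 inE.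
have p2 : perm_eq z2 (Y2 ++ enum B).
  apply: uniq_perm => //.
    rewrite cat_uniq !enum_uniq andbT; apply/hasPn => a; rewrite !mem_enum => aA.
    by rewrite inE aA.
  move=> a; rewrite mem_cat !mem_enum !inE e2 inE.
  case aA: (a \in B) => /=; last by rewrite orbF.
  by have := subsetP BS a aA; rewrite e2 inE.
rewrite (eps_cat p1 p2).
set e12 := eps ((Y1 ++ enum A) ++ Y2 ++ enum B).
have q1 : eps (Y1 ++ enum A) * eps (Y1 ++ enum A) = 1.
  by apply: eps_sq; rewrite -(perm_uniq p1).
have q2 : eps (Y2 ++ enum B) * eps (Y2 ++ enum B) = 1.
  by apply: eps_sq; rewrite -(perm_uniq p2).
rewrite !rmorphM rmorphXn rmorphN1.
move: q1 q2; set a1 := eps (Y1 ++ _); set a2 := eps (Y2 ++ _) => q1 q2.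
transitivity (pluck x Y1 * pluck y Y2 * (-1) ^+ (l * (#|S1| - k)) * e12%:~R * (a1 * a1)%:~R * (a2 * a2)%:~R).
  rewrite q1 q2 rmorph1; ring.
rewrite !rmorphM; ring.
Qed.

End Dual.

(** * Contraction and the product rule *)

Section Induced.
Variables (K L : fieldType) (phi : {rmorphism K -> L}) (T T' : finType).
Implicit Types (x : ext K T) (h : T -> ext L T').

Lemma over_induced S S' x h : over S x -> (forall t, t \in S -> over S' (h t)) ->
  over S' (induced phi h x).
Proof.
move=> ox oh; rewrite inducedE; apply: over_sum => A _.
have [AS|/ox ->] := boolP (A \subset S); last by rewrite rmorph0 scale0r; exact: over0.
apply: overZ; rewrite big_seq_cond; apply: over_prod => t.
by rewrite mem_enum andbT => /(subsetP AS); exact: oh.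
Qed.

Lemma homog_induced k x h : homog k x -> (forall t, homog 1 (h t)) ->
  homog k (induced phi h x).
Proof.
move=> hx hh; rewrite inducedE; apply: homog_sum => A _.
have [kA|/hx ->] := eqVneq #|A| k; last by rewrite rmorph0 scale0r; exact: homog0.
apply: homogZ; rewrite -(big_map h xpredT id) -kA cardE -(size_map h).
by apply: homog_prod => v /mapP[t _ ->].
Qed.

(** Allows a change of port list: only the images of the ground set of [x] matter. *)
Lemma eq_induced S x h h' : over S x -> (forall t, t \in S -> h t = h' t) ->
  induced phi h x = induced phi h' x.
Proof.
move=> ox hh; rewrite !inducedE; apply: eq_bigr => A _.
have [AS|/ox ->] := boolP (A \subset S); last by rewrite rmorph0 !scale0r.
congr (_ *: _); apply: eq_big_seq => t; rewrite mem_enum => /(subsetP AS); exact: hh.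
Qed.

Lemma induced_comm k m x h v : homog k x ->
  (forall t, h t * v = (-1) ^+ m *: (v * h t)) ->
  induced phi h x * v = (-1) ^+ (k * m) *: (v * induced phi h x).
Proof.
move=> hx hv; rewrite !inducedE mulr_suml mulr_sumr scaler_sumr; apply: eq_bigr => A _.
have [<-|/hx ->] := eqVneq #|A| k; last first.
  by rewrite rmorph0 !scale0r mul0r mulr0 scaler0.
rewrite -scalerAl -scalerAr scalerA mulrC -scalerA; congr (_ *: _); rewrite cardE.
elim: (enum A) => [|t s IH]; first by rewrite big_nil mul1r mulr1 mul0n scale1r.
rewrite big_cons -mulrA IH -scalerAr mulrA hv -scalerAl scalerA mulrA mulSn addnC exprD.
by [].
Qed.

End Induced.

Section Contraction.
Variables (F : fieldType) (T : finType).
Implicit Types (x y : ext F T) (S : {set T}).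

Lemma pluck_contract x e s : pluck (contract x e) s = pluck x (rcons s e).
Proof.
rewrite pluck_expand //.
have [a b] := alternating_cat [::] [:: e] (pluck_alternating x).
by split=> [t /a|s1 s2 u v]; rewrite -!cats1 //; exact: b.
Qed.

(** The last letter of [X] is contracted first, and letters contracted later are inserted before it,
    so [X] reappears in its own order. *)
Lemma pluck_contract_seq x X s : pluck (contract_seq x X) s = pluck x (s ++ X).
Proof.
elim: X s => [|e X IH] s /=; first by rewrite cats0.
by rewrite pluck_contract IH cat_rcons.
Qed.

Lemma pluck_eq x y : (forall s, pluck x s = pluck y s) -> x = y.
Proof. by move=> h; apply/extP => A; rewrite -!pluck_enum. Qed.

Lemma pluckZ a x s : pluck (a *: x) s = a * pluck x s.
Proof. by rewrite /pluck coefZ; case: ifP => _; [rewrite mulrCA|rewrite mulr0]. Qed.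

Lemma pluckD x y s : pluck (x + y) s = pluck x s + pluck y s.
Proof. by rewrite /pluck coefD; case: ifP => _; [rewrite mulrDr|rewrite addr0]. Qed.

Lemma contract_seqD x y X : contract_seq (x + y) X = contract_seq x X + contract_seq y X.
Proof. by apply: pluck_eq => s; rewrite pluckD !pluck_contract_seq pluckD. Qed.

Lemma contract_seqZ a x X : contract_seq (a *: x) X = a *: contract_seq x X.
Proof. by apply: pluck_eq => s; rewrite pluckZ !pluck_contract_seq pluckZ. Qed.

Lemma over_contract_seq S x X : over S x -> over (S :\: [set t in X]) (contract_seq x X).
Proof.
move=> ox A nA; rewrite -pluck_enum pluck_contract_seq.
have [AS|nS] := boolP (A \subset S); last first.
  apply: over_pluck ox _; apply: contra nS => /subsetP h; apply/subsetP => a aA.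
  by apply: h; rewrite inE mem_cat mem_enum aA.
rewrite /pluck cat_uniq; case: hasP => [|h]; first by rewrite andbF.
case/negP: nA; apply/subsetP => a aA; rewrite !inE (subsetP AS a aA) andbT.
by apply/negP => aX; apply: h; exists a => //; rewrite /= mem_enum.
Qed.

(** Every coordinate of the contraction is a coordinate of [x] at a sequence containing [u]. This
    kills the terms that miss a letter of [E]. *)
Lemma contract_seq_notin S x X u : over S x -> u \notin S -> u \in X ->
  contract_seq x X = 0.
Proof.
move=> ox uS uX; apply/extP => A; rewrite coef0 -pluck_enum pluck_contract_seq.
apply: over_pluck ox _; apply: contra uS => /subsetP; apply.
by rewrite inE mem_cat uX orbT.
Qed.

(** At [A B] the left side reads the product at [A B X1 X2]. Moving [B] across [X1] separates the
    factors, and the degree of [y] fixes the size of [B]. *)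
Lemma contract_seq_mul S1 S2 x y k X1 X2 : [disjoint S1 & S2] ->
  over S1 x -> over S2 y -> homog k y -> {subset X1 <= S1} -> {subset X2 <= S2} ->
  contract_seq (x * y) (X1 ++ X2) =
  (-1) ^+ (size X1 * (k - size X2)) *: (contract_seq x X1 * contract_seq y X2).
Proof.
move=> dS ox oy hy X1S X2S.
have oc1 : over S1 (contract_seq x X1).
  exact: (over_sub (subsetDl _ _) (over_contract_seq ox)).
have oc2 : over S2 (contract_seq y X2).
  exact: (over_sub (subsetDl _ _) (over_contract_seq oy)).
have oM (u v : ext F T) : over S1 u -> over S2 v -> over (S1 :|: S2) (u * v).
  move=> ou ov; apply: overM; first exact: (over_sub (subsetUl _ _) ou).
  exact: (over_sub (subsetUr _ _) ov).
apply: (ext_split dS).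
- apply: (over_sub (subsetDl _ [set t in X1 ++ X2])); apply: over_contract_seq; exact: oM.
- by apply: overZ; exact: oM.
move=> A B AS BS; rewrite pluck_contract_seq pluckZ.
have AS' : {subset enum A <= S1} by move=> a; rewrite mem_enum; exact: (subsetP AS).
have BS' : {subset enum B <= S2} by move=> a; rewrite mem_enum; exact: (subsetP BS).
rewrite (pluck_mul dS oc1 oc2 AS' BS') !pluck_contract_seq.
rewrite -catA (alternating_swap _ _ _ _ (pluck_alternating _)) catA.
rewrite (pluck_mul dS) //; first last.
- by move=> a; rewrite mem_cat => /orP[/BS'|/X2S].
- by move=> a; rewrite mem_cat => /orP[/AS'|/X1S].
(* If the degree does not fit, both sides are zero; otherwise [X2] has at most [k] letters and the
   truncated subtraction in the sign is exact. *)
have [e|n] := eqVneq (size (enum B ++ X2)) k; last by rewrite (homog_pluck hy n) !mulr0.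
by rewrite -e size_cat addnK mulnC.
Qed.

End Contraction.

Lemma alternating_map (T T' : eqType) (V : zmodType) (j : T -> T') (f : seq T' -> V) :
  injective j -> alternating f -> alternating (fun s => f (map j s)).
Proof.
move=> ij [a b]; split=> [s ns|s1 s2 u v]; first by apply: a; rewrite map_inj_uniq.
by rewrite !map_cat /= b.
Qed.

(** Both [f] and the coordinate at [s] followed by the image of [X] alternate in [X]. With [f] built
    from [eps], this gives independence of the order of [E]. *)
Lemma contract_seq_perm (F : fieldType) (T T' : finType) (j : T -> T') (f : seq T -> F)
    (x : ext F T') X Y : injective j -> alternating f -> perm_eq X Y ->
  f X *: contract_seq x (map j X) = f Y *: contract_seq x (map j Y).
Proof.
move=> ij af XY; apply: pluck_eq => s; rewrite !pluckZ !pluck_contract_seq.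
apply: (alternatingM (h := fun X => pluck x (s ++ map j X)) af) XY.
have [a b] := alternating_cat s [::] (pluck_alternating x).
have /(alternating_map ij) : alternating (fun t => pluck x (s ++ t)).
  by split=> [t /a|s1 s2 u v]; rewrite ?cats0 //; have := b s1 s2 u v; rewrite !cats0.
by [].
Qed.

(** * The product rule for ported extensors *)

Section PortedProduct.
Variables (K L : fieldType) (phi : {rmorphism K -> L}) (T : finType).
Variables (eps : seq T -> int) (g r : T -> L).
Hypothesis eps_go : ground_orientation eps.
Implicit Types (x y : ext K T) (S : {set T}).

(** Forgets which copy a letter belongs to. Its preimages [lift_set] bound the support of
    [extensor_M] generously, but finely enough to keep disjoint ground sets apart. *)
Definition strip (u : ported T) : T :=
  match u with inl (inl t) => t | inl (inr t) => t | inr t => t end.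

Definition lift_set S : {set ported T} := [set u | strip u \in S].

Lemma lift_set_disjoint S1 S2 : [disjoint S1 & S2] -> [disjoint lift_set S1 & lift_set S2].
Proof.
move=> d; rewrite -setI_eq0; apply/eqP/setP => u; rewrite !inE.
by move/disjoint_setI0/setP/(_ (strip u)): d; rewrite !inE.
Qed.

Lemma over_iotag S P t : t \in S -> over (lift_set S) (iotag g P t).
Proof.
by move=> tS; rewrite /iotag; case: ifP => _; [|apply: overZ]; apply: over_gen; rewrite inE.
Qed.

Lemma over_upsilonr S P t : t \in S -> over (lift_set S) (upsilonr r P t).
Proof.
by move=> tS; rewrite /upsilonr; case: ifP => _; [|apply: overZ]; apply: over_gen; rewrite inE.
Qed.

Lemma homog_iotag P t : homog 1 (iotag g P t).
Proof. by rewrite /iotag; case: ifP => _; [|apply: homogZ]; exact: homog_gen. Qed.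

Lemma homog_upsilonr P t : homog 1 (upsilonr r P t).
Proof. by rewrite /upsilonr; case: ifP => _; [|apply: homogZ]; exact: homog_gen. Qed.

Lemma iotag_upsilonr P s t : iotag g P s * upsilonr r P t = - (upsilonr r P t * iotag g P s).
Proof.
by rewrite /iotag /upsilonr; do 2 case: ifP => _; rewrite -?scalerAl -?scalerAr gen_anti;
  rewrite ?scalerN // scalerA mulrC -scalerA.
Qed.

(** All images of letters have degree 1 and anticommute, also across the two homomorphisms. *)
Lemma iota_upsilon_comm P k m x y : homog k x -> homog m y ->
  induced phi (iotag g P) x * induced phi (upsilonr r P) y =
  (-1) ^+ (k * m) *: (induced phi (upsilonr r P) y * induced phi (iotag g P) x).
Proof.
move=> hx hy; apply: induced_comm => // t.
(* The commutation is applied from the other side; its sign is its own inverse. *)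
rewrite (induced_comm phi (m := 1) hy) => [|s].
  by rewrite muln1 scalerA -exprD addnn -mul2n exprM sqrrN expr1n expr1n scale1r.
by rewrite iotag_upsilonr expr1 scaleN1r opprK.
Qed.

Lemma over_extensor_M P E x : over [set t in P ++ E] x ->
  over (lift_set [set t in P ++ E]) (extensor_M phi eps g r P E x).
Proof.
move=> ox; apply: overM; first by apply: over_induced ox _ => t; exact: over_iotag.
by apply: over_induced (@over_dual _ _ _ _ _) _ => t; exact: over_upsilonr.
Qed.

(** The degrees [k] of [x] and n - k of its dual add up to the size n of the ground set, whatever
    [k] is. If [k] exceeds n, then [x] is zero. *)
Lemma homog_extensor_M P E k x : homog k x -> over [set t in P ++ E] x ->
  homog #|[set t in P ++ E]| (extensor_M phi eps g r P E x).
Proof.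
move=> hx ox; have [le|lt] := leqP k #|[set t in P ++ E]|.
  rewrite -{1}(subnKC le); apply: homogM; apply: homog_induced.
  - by [].
  - exact: homog_iotag.
  - exact: homog_dual.
  - exact: homog_upsilonr.
suff -> : x = 0 by rewrite /extensor_M induced0 mul0r; exact: homog0.
apply/extP => A; rewrite coef0; have [/subset_leq_card AS|/ox //] := boolP (A \subset [set t in P ++ E]).
by apply: hx; rewrite neq_ltn (leq_ltn_trans AS lt).
Qed.

(** Regrouping the four factors moves the image of [y] past that of the dual of [x], of degrees [l]
    and [#|S1| - k]. The resulting sign is the one in [dual_mul], so the two cancel and no rank
    remains in the formula. *)
Lemma extensor_M_mul P1 E1 P2 E2 E x y k l :
  uniq (P1 ++ E1) -> uniq (P2 ++ E2) -> [disjoint [set t in P1 ++ E1] & [set t in P2 ++ E2]] ->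
  perm_eq E (E1 ++ E2) ->
  over [set t in P1 ++ E1] x -> over [set t in P2 ++ E2] y -> homog k x -> homog l y ->
  extensor_M phi eps g r (P1 ++ P2) E (x * y) =
  (eps ((P1 ++ E1) ++ (P2 ++ E2)) * eps (P1 ++ E1) * eps (P2 ++ E2))%:~R *:
    (extensor_M phi eps g r P1 E1 x * extensor_M phi eps g r P2 E2 y).
Proof.
move=> u1 u2 d pE ox oy hx hy; rewrite /extensor_M.
have -> : [set t in (P1 ++ P2) ++ E] = [set t in P1 ++ E1] :|: [set t in P2 ++ E2].
  by apply/setP => a; rewrite !inE !mem_cat (perm_mem pE) mem_cat; do 4 case: (a \in _).
rewrite (dual_mul eps_go d u1 u2 erefl erefl ox oy hx hy).
set S1 := [set t in P1 ++ E1]; set S2 := [set t in P2 ++ E2].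
have mem1 t : t \in S1 -> t \in P2 = false.
  move=> t1; apply/negP => t2; move/disjoint_setI0/setP/(_ t): d; rewrite !inE -/S1.
  by move: t1; rewrite !inE => ->; rewrite mem_cat t2.
have mem2 t : t \in S2 -> t \in P1 = false.
  move=> t1; apply/negP => t2; move/disjoint_setI0/setP/(_ t): d; rewrite !inE -/S1.
  by move: t1; rewrite !inE => ->; rewrite mem_cat t2.
set h := iotag g (P1 ++ P2); set h' := upsilonr r (P1 ++ P2).
rewrite inducedZ (inducedM phi (@iotag_sq _ _ _ _) (@iotag_anti _ _ _ _)).
rewrite (inducedM phi (@upsilonr_sq _ _ _ _) (@upsilonr_anti _ _ _ _)).
(* On each ground set the homomorphisms for the joint port list agree with those for its own ports,
   since the other ports do not occur there. *)
have <- : induced phi h x = induced phi (iotag g P1) x.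
  by apply: eq_induced ox _ => t /mem1 e; rewrite /h /iotag mem_cat e orbF.
have <- : induced phi h y = induced phi (iotag g P2) y.
  by apply: eq_induced oy _ => t /mem2 e; rewrite /h /iotag mem_cat e.
have <- : induced phi h' (dual eps S1 x) = induced phi (upsilonr r P1) (dual eps S1 x).
  by apply: eq_induced (@over_dual _ _ _ _ _) _ => t /mem1 e; rewrite /h' /upsilonr mem_cat e orbF.
have <- : induced phi h' (dual eps S2 y) = induced phi (upsilonr r P2) (dual eps S2 y).
  by apply: eq_induced (@over_dual _ _ _ _ _) _ => t /mem2 e; rewrite /h' /upsilonr mem_cat e.
rewrite -scalerAr -!mulrA (mulrA (induced _ _ y)).
rewrite (iota_upsilon_comm _ hy (homog_dual eps (S := S1) hx)).
rewrite -scalerAl -scalerAr scalerA !mulrA; congr (_ *: _).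
rewrite rmorphM rmorphXn rmorphN1 mulrAC -expr2 -exprM mulnC exprM sqrrN !expr1n mul1r.
by rewrite rmorph_int.
Qed.

(* [contract_seq _ E] and [eps (P ++ E)] both alternate in [E], so this does not depend on
   the order of [E]. *)
Definition normalized_ME P E x : ext L (ported T) :=
  (eps (P ++ E))%:~R *: extensor_ME phi eps g r P E x.

Lemma elt_inj : injective (@elt T). Proof. by move=> ? ? []. Qed.

(** Contracting [E1 ++ E2] from the product costs [E1] crossing as many letters as [P2] has, since
    the second factor has degree [size P2 + size E2]. Exchanging [P2] and [E1] inside [eps] costs
    the same sign, and the value of [eps] that is left squares to 1. *)
Lemma normalized_ME_mul P1 E1 P2 E2 E x y k l :
  uniq (P1 ++ E1) -> uniq (P2 ++ E2) -> [disjoint [set t in P1 ++ E1] & [set t in P2 ++ E2]] ->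
  perm_eq E (E1 ++ E2) ->
  over [set t in P1 ++ E1] x -> over [set t in P2 ++ E2] y -> homog k x -> homog l y ->
  normalized_ME (P1 ++ P2) E (x * y) = normalized_ME P1 E1 x * normalized_ME P2 E2 y.
Proof.
move=> u1 u2 d pE ox oy hx hy; rewrite /normalized_ME /extensor_ME.
case: (eps_go) => alt _ _.
have alt' : alternating (fun s => (eps ((P1 ++ P2) ++ s))%:~R : L).
  apply: alternating_intr.
  by have [a b] := alternating_cat (P1 ++ P2) [::] alt; split=> [s /a|s1' s2' u v];
    rewrite ?cats0 //; have := b s1' s2' u v; rewrite !cats0.
rewrite (contract_seq_perm _ elt_inj alt' pE) (extensor_M_mul u1 u2 d pE ox oy hx hy).
rewrite map_cat contract_seqZ.
have subE P E' : {subset map (@elt T) E' <= lift_set [set t in P ++ E']}.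
  by move=> ? /mapP[t tE ->]; rewrite !inE mem_cat tE orbT.
rewrite (contract_seq_mul (lift_set_disjoint d) (over_extensor_M ox) (over_extensor_M oy)
  (homog_extensor_M hy oy) (subE P1 E1) (subE P2 E2)).
rewrite -scalerAl -scalerAr !scalerA; congr (_ *: _).
rewrite !size_map cardsE (card_uniqP u2) size_cat addnK.
rewrite -(catA P1 P2) (alternating_swap P1 P2 E1 E2 alt) -(catA P1 E1).
set e := eps (P1 ++ E1 ++ P2 ++ E2).
have e2 : e * e = 1.
  apply: eps_sq => //; rewrite catA cat_uniq u1 u2 andbT; apply/hasPn => a a2.
  by apply/negP => a1; move/disjoint_setI0/setP/(_ a): d; rewrite !in_setI !inE a2 /= a1.
set e1 := eps (P1 ++ E1); set e3 := eps (P2 ++ E2).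
rewrite !rmorphM rmorphXn rmorphN1 mulnC.
have := sqrr_sign L (size E1 * size P2); rewrite expr2; move: ((-1) ^+ _) => z zz.
transitivity ((z * z) * (e * e)%:~R * (e1%:~R * e3%:~R)); first by rewrite rmorphM /=; ring.
by rewrite e2 zz rmorph1 !mul1r.
Qed.

End PortedProduct.

(** * Minors of extensors *)

Section Extensor.
Variables (F : fieldType) (T : finType).
Implicit Types (x y u v w : ext F T) (S : {set T}) (vs ws : seq (ext F T)).

Definition vectors S vs := forall v, v \in vs -> vector_over S v.

Lemma vectors_cons S v vs : vectors S (v :: vs) <-> vector_over S v /\ vectors S vs.
Proof.
split=> [h|[h hs] w]; last by rewrite inE => /orP[/eqP ->|/hs].
by split=> [|w ws]; apply: h; rewrite inE ?eqxx ?ws ?orbT.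
Qed.

Lemma vector_overD S u v : vector_over S u -> vector_over S v -> vector_over S (u + v).
Proof.
move=> [a ->] [b ->]; exists (fun t => a t + b t); rewrite -big_split.
by apply: eq_bigr => t _; rewrite scalerDl.
Qed.

Lemma vector_overZ S c v : vector_over S v -> vector_over S (c *: v).
Proof.
move=> [a ->]; exists (fun t => c * a t); rewrite scaler_sumr.
by apply: eq_bigr => t _; rewrite scalerA.
Qed.

Lemma vector_over_sub S S' v : S \subset S' -> vector_over S v -> vector_over S' v.
Proof.
move=> /subsetP SS [a ->]; exists (fun t => if t \in S then a t else 0).
rewrite big_mkcond [RHS]big_mkcond; apply: eq_bigr => t _ /=.
by case: ifP => [/SS -> //|_]; rewrite scale0r if_same.
Qed.

Lemma vector_over_split S e v : vector_over S v ->
  exists a v', vector_over (S :\ e) v' /\ v = a *: gen F e + v'.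
Proof.
move=> [a ->]; have [eS|eS] := boolP (e \in S); last first.
  exists 0, (\sum_(t in S) a t *: gen F t); rewrite scale0r add0r; split=> //.
  have -> : S :\ e = S by apply/setP => t; rewrite !inE; case: eqP => // ->; rewrite (negbTE eS).
  by exists a.
exists (a e), (\sum_(t in S :\ e) a t *: gen F t); split; first by exists a.
by rewrite (big_setD1 e).
Qed.

Lemma vector_anti S u v : vector_over S u -> vector_over S v -> u * v = - (v * u).
Proof.
move=> [a ->] [b ->]; rewrite mulr_suml mulr_sumr -sumrN; apply: eq_bigr => s _.
rewrite mulr_sumr mulr_suml -sumrN; apply: eq_bigr => t _.
by rewrite -!scalerAl -!scalerAr gen_anti !scalerN !scalerA mulrC.
Qed.

Lemma vector_sq S v : vector_over S v -> v * v = 0.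
Proof.
move=> [a ->]; rewrite -big_enum; elim: (enum S) => [|s l IH]; first by rewrite big_nil mulr0.
rewrite big_cons mulrDl !mulrDr IH addr0 -scalerAl -scalerAr gen_sq !scaler0 add0r.
rewrite mulr_suml mulr_sumr -big_split big1 //= => t _.
by rewrite -!scalerAl -!scalerAr gen_anti !scalerN !scalerA mulrC addNr.
Qed.

Lemma vector_comm S v ws : vector_over S v -> vectors S ws ->
  v * \prod_(w <- ws) w = (-1) ^+ size ws *: (\prod_(w <- ws) w * v).
Proof.
move=> hv; elim: ws => [|w ws IH]; first by rewrite big_nil mulr1 mul1r scale1r.
move=> /vectors_cons [hw hws]; rewrite big_cons mulrA (vector_anti hv hw) mulNr -(mulrA w v) IH //.
by rewrite -scalerAr -scaleNr /= exprS mulN1r mulrA.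
Qed.

Lemma over_vector S v : vector_over S v -> over S v.
Proof.
by move=> [a ->]; apply: over_sum => t tS; apply: overZ; exact: over_gen.
Qed.

Lemma homog_vector S v : vector_over S v -> homog 1 v.
Proof. by move=> [a ->]; apply: homog_sum => t tS; apply: homogZ; exact: homog_gen. Qed.

Lemma over_vectors S vs : vectors S vs -> over S (\prod_(v <- vs) v).
Proof.
move=> h; rewrite big_seq_cond; apply: over_prod => v; rewrite andbT => /h; exact: over_vector.
Qed.

(** A single form for both clauses of [extensor]: the scalar is absorbed by the first factor, and
    only the empty product keeps it. *)
Lemma extensorP S x : extensor S x <->
  exists c vs, vectors S vs /\ x = c *: \prod_(v <- vs) v.
Proof.
split=> [[[c ->]|[vs [h ->]]]|[c [vs [h ->]]]].
- by exists c, [::]; rewrite big_nil.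
- by exists 1, vs; rewrite scale1r.
case: vs h => [|v vs] h; first by left; exists c; rewrite big_nil.
right; exists (c *: v :: vs); rewrite !big_cons scalerAl; split=> //.
by move/vectors_cons: h => [hv hvs]; apply/vectors_cons; split=> //; exact: vector_overZ.
Qed.

Lemma over_extensor S x : extensor S x -> over S x.
Proof. by move=> /extensorP [c [vs [h ->]]]; apply: overZ; exact: over_vectors. Qed.

Lemma homog_extensor S x : extensor S x -> exists k, homog k x.
Proof.
move=> /extensorP [c [vs [h ->]]]; exists (size vs); apply: homogZ; apply: homog_prod => v.
by move=> /h; exact: homog_vector.
Qed.

Lemma extensor_mul S1 S2 x y : extensor S1 x -> extensor S2 y -> extensor (S1 :|: S2) (x * y).
Proof.
move=> /extensorP [c [vs [h ->]]] /extensorP [d [ws [k ->]]]; apply/extensorP.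
exists (c * d), (vs ++ ws); rewrite big_cat -scalerAl -scalerAr scalerA; split=> // v.
rewrite mem_cat => /orP[/h|/k]; apply: vector_over_sub; [exact: subsetUl|exact: subsetUr].
Qed.

Lemma contract_gen (e : T) : contract_seq (gen F e) [:: e] = 1.
Proof.
apply/extP => A; rewrite -pluck_enum pluck_contract_seq [RHS]coef_base.
have [->|[a aA]] := set_0Vmem A.
  by rewrite enum_set0 eqxx /= -(enum_set1 e) pluck_enum coef_base eqxx.
rewrite (homog_pluck (@homog_gen F T e)); last first.
  by rewrite size_cat -cardE addn1 eqSS cards_eq0; apply/set0Pn; exists a.
by case: eqP aA => // ->; rewrite inE.
Qed.

Lemma contract_mul_gen S x e : over S x -> e \notin S -> contract (x * gen F e) e = x.
Proof.
move=> ox eS; have d : [disjoint S & [set e]] by rewrite disjoint_sym disjoints1.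
have := @contract_seq_mul F T S [set e] x (gen F e) 1 [::] [:: e] d ox.
rewrite contract_gen mul0n scale1r mulr1; apply=> //.
- by apply: over_gen; rewrite inE.
- exact: homog_gen.
- by move=> t; rewrite !inE.
Qed.

Lemma contract_notin S x e : over S x -> e \notin S -> contract x e = 0.
Proof. by move=> ox eS; apply: (contract_seq_notin (X := [:: e]) ox eS); rewrite inE. Qed.

Lemma over_contract S x e : over S x -> over (S :\ e) (contract x e).
Proof.
move=> ox; have := over_contract_seq (X := [:: e]) ox.
by have -> : [set t in [:: e]] = [set e] by apply/setP => t; rewrite !inE.
Qed.

Lemma homog_contract k x e : homog k x -> homog k.-1 (contract x e).
Proof.
move=> hx A nA; rewrite -pluck_enum pluck_contract (homog_pluck hx) // size_rcons -cardE.
by apply: contra nA => /eqP <-.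
Qed.

(* Gaussian elimination of [e] from all but one factor. *)
Lemma prod_eliminate S e vs : vectors S vs ->
  exists2 ws, vectors (S :\ e) ws & \prod_(v <- vs) v = \prod_(w <- ws) w \/
    exists2 u, vector_over S u & \prod_(v <- vs) v = u * \prod_(w <- ws) w.
Proof.
elim: vs => [_|v vs IH /vectors_cons [hv /IH [ws hws IHvs]]].
  by exists [::] => //; left.
rewrite big_cons; case: IHvs => [->|[u hu ->]].
  by exists ws => //; right; exists v.
have [b [u' [hu' eu]]] := vector_over_split e hu.
have [a [v' [hv' ev]]] := vector_over_split e hv.
have [b0|b0] := eqVneq b 0.
  exists (u' :: ws); first by apply/vectors_cons.
  by right; exists v => //; rewrite big_cons eu b0 scale0r add0r.
(* The pivot [u] stays in front, and [v] is replaced by a multiple of [u] minus [v] in which [e]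
   cancels. The product is unchanged, because [u] squares to 0 and anticommutes with [v]. *)
exists ((a / b) *: u' - v' :: ws).
  apply/vectors_cons; split=> //; apply: vector_overD; first exact: vector_overZ.
  by rewrite -scaleN1r; exact: vector_overZ.
right; exists u => //; rewrite big_cons !mulrA; congr (_ * _).
have -> : (a / b) *: u' - v' = (a / b) *: u - v.
  by rewrite eu ev scalerDr scalerA divfK // opprD addrACA subrr add0r.
by rewrite mulrBr -scalerAr (vector_sq hu) scaler0 sub0r (vector_anti hv hu).
Qed.

Lemma contractD x y e : contract (x + y) e = contract x e + contract y e.
Proof. exact: (contract_seqD x y [:: e]). Qed.

Lemma contractZ a x e : contract (a *: x) e = a *: contract x e.
Proof. exact: (contract_seqZ a x [:: e]). Qed.

(** After elimination at most the pivot contains [e]. Contraction replaces the pivot by its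
    coefficient at [e], up to the sign of moving [e] to the end, and leaves the product of the other
    factors. *)
Lemma extensor_contract S x e : extensor S x -> extensor (S :\ e) (contract x e).
Proof.
move=> /extensorP [c [vs [/(prod_eliminate e) [ws hws H] ->]]]; apply/extensorP.
have eS : e \notin S :\ e by rewrite !inE eqxx.
have oW := over_vectors hws.
case: H => [->|[u hu ->]].
  by exists 0, [::]; rewrite scale0r contractZ (contract_notin oW eS) scaler0.
have [b [u' [hu' ->]]] := vector_over_split e hu.
exists (c * (b * (-1) ^+ size ws)), ws; split=> //.
have ge : vector_over [set: T] (gen F e).
  exists (fun t => (t == e)%:R); rewrite (bigD1 e) ?inE //= eqxx scale1r big1 ?addr0 //.
  by move=> t /andP[_ /negbTE ->]; rewrite scale0r.
have hws' : vectors [set: T] ws.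
  by move=> w /hws; apply: vector_over_sub; exact: subsetT.
rewrite mulrDl contractZ contractD -scalerAl (vector_comm ge hws') !contractZ.
rewrite (contract_mul_gen oW eS) (contract_notin _ eS) ?addr0 ?scalerA ?mulrA //.
by apply: overM => //; exact: over_vector.
Qed.

(** Deletion is encoded as the algebra homomorphism that sends [e] to 0; multiplicativity then shows
    at once that it preserves extensors. *)
Definition delete_gen e (t : T) : ext F T := if t == e then 0 else gen F t.

Definition delete x e : ext F T := induced (idfun : {rmorphism F -> F}) (delete_gen e) x.

Lemma deleteM x y e : delete (x * y) e = delete x e * delete y e.
Proof.
apply: inducedM => [t|s t]; rewrite /delete_gen; first by case: ifP; rewrite ?mulr0 ?gen_sq.
by do 2 case: ifP => _; rewrite ?(mulr0, mul0r, oppr0) // gen_anti.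
Qed.

Lemma coef_delete x e A : coef (delete x e) A = if e \in A then 0 else coef x A.
Proof.
have key (B : {set T}) : \prod_(t <- enum B) delete_gen e t = if e \in B then 0 else ebase F B.
  case: ifP => [eB|eB]; last first.
    rewrite -mon_enum; apply: eq_big_seq => t; rewrite mem_enum /delete_gen => tB.
    by case: eqP => // te; rewrite -te tB in eB.
  have : e \in enum B by rewrite mem_enum.
  elim: (enum B) => //= t s IH; rewrite inE big_cons /delete_gen eq_sym.
  by case: (t =P e) => [_ _|_ /= /IH ->]; rewrite ?mul0r ?mulr0.
rewrite /delete inducedE coef_sum (bigD1 A) //= [X in _ + X]big1 ?addr0.
  by rewrite coefZ key; case: ifP => _; rewrite ?coef0 ?mulr0 // coef_base eqxx mulr1.
move=> B nB; rewrite coefZ key; case: ifP => _; rewrite ?coef0 ?mulr0 //.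
by rewrite coef_base eq_sym (negbTE nB) mulr0.
Qed.

Lemma pluck_delete x e (s : seq T) : pluck (delete x e) s = if e \in s then 0 else pluck x s.
Proof.
by rewrite /pluck coef_delete inE; case: (e \in s); rewrite ?mulr0 ?if_same.
Qed.

Lemma over_delete S x e : over S x -> over (S :\ e) (delete x e).
Proof.
move=> ox A; rewrite coef_delete subsetD1 negb_and negbK.
by case: ifP => //= _; rewrite orbF; exact: ox.
Qed.

Lemma homog_delete k x e : homog k x -> homog k (delete x e).
Proof. by move=> hx A nA; rewrite coef_delete hx // if_same. Qed.

Lemma extensor_delete S x e : extensor S x -> extensor (S :\ e) (delete x e).
Proof.
move=> /extensorP [c [vs [h ->]]]; apply/extensorP; exists c, [seq delete v e | v <- vs]; split.
  move=> ? /mapP[v /h hv ->]; have [a [v' [hv' ->]]] := vector_over_split e hv.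
  suff -> : delete (a *: gen F e + v') e = v' by [].
  apply/extP => A; rewrite coef_delete coefD coefZ; case: ifP => eA.
    rewrite (over_vector hv') //; by apply/subsetPn; exists e; rewrite // !inE eqxx.
  by rewrite coef_base; case: eqP eA => [->|_ _]; rewrite ?inE ?eqxx // mulr0 add0r.
rewrite /delete inducedZ big_map; congr (_ *: _).
by apply: (big_morph (delete^~ e)) => [x' y'|]; [exact: deleteM|exact: induced1].
Qed.

(** Sorts the monomials by whether they contain [e], which is moved to the last place. Coordinates
    are tested at [A] followed by [e] or by nothing, and each case sees one summand only. *)
Lemma contract_delete x e : x = contract x e * gen F e + delete x e.
Proof.
set S := [set: T] :\ e; have oT : over [set: T] x by move=> A; rewrite subsetT.
have d : [disjoint S & [set e]].
  by rewrite disjoint_sym disjoints1 !inE eqxx.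
have o y : over (S :|: [set e]) y.
  by move=> A; rewrite setUC setD1K ?subsetT ?inE.
have oc : over S (contract x e) := over_contract oT; have og : over [set e] (gen F e).
  by apply: over_gen; rewrite inE.
apply: (ext_split d (o _) (o _)) => A B AS BS; rewrite pluckD pluck_delete.
have AS' : {subset enum A <= S} by move=> a; rewrite mem_enum; exact: (subsetP AS).
have BS' : {subset enum B <= [set e]} by move=> a; rewrite mem_enum; exact: (subsetP BS).
rewrite (pluck_mul d oc og AS' BS') pluck_contract mem_cat !mem_enum.
have eA : e \in A = false by apply/negP => /(subsetP AS); rewrite !inE eqxx.
move: BS; rewrite subset1 => /orP[/eqP ->|/eqP ->]; rewrite pluck_enum coef_base.
  by rewrite eqxx enum_set1 inE eqxx orbT addr0 mulr1 cats1.
rewrite eA in_set0 /= enum_set0 cats0 (_ : (set0 == _) = false) ?mulr0 ?add0r //.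
by apply/negbTE/eqP => /setP /(_ e); rewrite !inE eqxx.
Qed.

End Extensor.

(** * Presentations and the recursion *)

(** A letter of [S2] at the front has to cross exactly the later letters of [S1], which [nshuffle]
    counts. The prefix [p] makes the induction go through. *)
Lemma alternating_nshuffle (V : nzRingType) (T : finType) (f : seq T -> V) (S1 S2 : {set T}) p s :
  alternating f -> [disjoint S1 & S2] -> all (fun t => t \in S1 :|: S2) s ->
  f (p ++ s) = (-1) ^+ nshuffle S1 S2 s *
    f (p ++ [seq t <- s | t \in S1] ++ [seq t <- s | t \in S2]).
Proof.
move=> af d; elim: s p => [|t s IH] p /=; first by rewrite mul1r.
move=> /andP[]; rewrite inE => tS /IH {}IH; rewrite -cat_rcons IH.
have [t1|t1] := boolP (t \in S1).
  have -> : t \in S2 = false.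
    by apply/negP => t2; move/disjoint_setI0/setP/(_ t): d; rewrite !inE t1 t2.
  by rewrite add0n cat_rcons.
move: tS; rewrite (negbTE t1) => /= ->; rewrite cat_rcons mul1n.
have -> : [:: t & [seq u <- s | u \in S1] ++ [seq u <- s | u \in S2]] =
    [:: t] ++ [seq u <- s | u \in S1] ++ [seq u <- s | u \in S2] by [].
by rewrite (alternating_swap _ _ _ _ af) /= mul1n size_filter mulrA -exprD addnC.
Qed.

Section Presentations.
Variables (R : realType) (PK : {pred R}) (K : subFieldType PK) (T : finType).
Implicit Types (N : ext K T) (M : omat T).

Lemma ext_neq0 N : N != 0 -> exists A, coef N A != 0.
Proof.
move=> nN; apply/existsP; apply: contraNT nN; rewrite negb_exists => /forallP h.
by apply/eqP/extP => A; rewrite coef0; apply/eqP; rewrite -[_ == _]negbK.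
Qed.

Lemma presents_chi0 N M B : presents N M -> (chi M B == 0) = (pluck N B == 0).
Proof.
move=> [_ _ [b h]].
have -> : (pluck N B == 0) = (val (pluck N B) == 0) by rewrite fmorph_eq0.
by rewrite -[RHS]sgz_eq0 h mulf_eq0 signr_eq0.
Qed.

(** A basis through [e], reordered so that [e] is last, shows that the contraction is nonzero. The
    global sign [b] is inherited. *)
Lemma presents_contract N M e : ~~ loop M e -> presents N M -> unimodular N ->
  presents (contract N e) (om_contract M e) /\ unimodular (contract N e).
Proof.
move=> nl pN uN; have [eN _ [b h]] := pN; split; last first.
  by move=> B; rewrite pluck_contract.
rewrite /om_contract (negbTE nl); split=> /=.
- exact: extensor_contract.
- move: nl; rewrite /loop negb_forall => /existsP[B]; rewrite negb_imply negbK inE.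
  rewrite (presents_chi0 _ pN) => /andP[cB eB]; apply: contraNneq cB => c0.
  have cE s : pluck N (rcons s e) = 0.
    by rewrite -pluck_contract c0 /pluck coef0 mulr0 if_same.
  apply/eqP/esym; rewrite -(setD1K eB).
  apply: (alternating_eq (f := fun=> 0) _ (pluck_alternating N) _ (esym (cE (enum (B :\ e))))).
    by split=> // *; rewrite oppr0.
  apply: uniq_perm; rewrite ?enum_uniq //.
    by rewrite rcons_uniq mem_enum !inE eqxx enum_uniq.
  by move=> a; rewrite mem_rcons in_cons !mem_enum !inE.
- by exists b => B; rewrite pluck_contract h.
Qed.

(** Here a basis avoiding [e] shows that the deletion is nonzero. *)
Lemma presents_delete N M e : ~~ coloop M e -> presents N M -> unimodular N ->
  presents (delete N e) (om_delete M e) /\ unimodular (delete N e).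
Proof.
move=> nl pN uN; have [eN _ [b h]] := pN; split; last first.
  by move=> B; rewrite pluck_delete; case: ifP => _; rewrite ?uN // inE eqxx.
rewrite /om_delete (negbTE nl); split=> /=.
- exact: extensor_delete.
- move: nl; rewrite /coloop negb_forall => /existsP[B]; rewrite negb_imply inE.
  rewrite (presents_chi0 _ pN) => /andP[cB eB]; apply: contraNneq cB => c0.
  have := coef_delete N e B; rewrite (negbTE eB) c0 coef0 -pluck_enum => <- //.
- by exists b => B; rewrite pluck_delete; case: ifP => _; rewrite ?h // rmorph0 sgz0 mulr0.
Qed.

(** Shuffling a sequence into its two parts and applying [pluck_mul] gives the chirotope of
    [om_sum]. The product is nonzero at a concatenation of two sets where the factors are
    nonzero. *)
Lemma presents_sum N1 N2 M1 M2 : [disjoint ground M1 & ground M2] ->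
  presents N1 M1 -> unimodular N1 -> presents N2 M2 -> unimodular N2 ->
  presents (N1 * N2) (om_sum M1 M2) /\ unimodular (N1 * N2).
Proof.
move=> d [e1 n1 [b1 h1]] u1 [e2 n2 [b2 h2]] u2.
have o1 := over_extensor e1; have o2 := over_extensor e2.
set S1 := ground M1; set S2 := ground M2.
have pE B : pluck (N1 * N2) B = if all (fun x => x \in S1 :|: S2) B then
    (-1) ^+ nshuffle S1 S2 B *
    (pluck N1 [seq x <- B | x \in S1] * pluck N2 [seq x <- B | x \in S2]) else 0.
  case: ifP => [aB|/negP nB]; last first.
    have oM : over (S1 :|: S2) (N1 * N2).
      by apply: overM; [apply: over_sub o1; exact: subsetUl|apply: over_sub o2; exact: subsetUr].
    apply: over_pluck oM _; apply/negP => /subsetP sB; apply: nB.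
    by apply/allP => t tB; apply: sB; rewrite inE.
  rewrite (alternating_nshuffle [::] (pluck_alternating (N1 * N2)) d aB) /=.
  by rewrite (pluck_mul d) // => t; rewrite mem_filter => /andP[].
split; last first.
  move=> B; rewrite pE; case: ifP => _; last by rewrite inE eqxx.
  move: (u1 [seq x <- B | x \in S1]) (u2 [seq x <- B | x \in S2]).
  rewrite -signr_odd !inE; case: (odd _) => /or3P[]/eqP-> /or3P[]/eqP->;
    by rewrite ?expr0 ?expr1 ?mulN1r ?mul1r ?(mulr0, mul0r, mulrN, mulr1, opprK, oppr0, eqxx, orbT).
split=> /=.
- exact: extensor_mul.
- have [A1 c1] := ext_neq0 n1; have [A2 c2] := ext_neq0 n2.
  have A1S : A1 \subset S1 by apply: contraNT c1 => /o1 ->.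
  have A2S : A2 \subset S2 by apply: contraNT c2 => /o2 ->.
  have : pluck (N1 * N2) (enum A1 ++ enum A2) != 0.
    rewrite (pluck_mul d o1 o2); first by rewrite !pluck_enum mulf_neq0.
    - by move=> t; rewrite mem_enum; exact: (subsetP A1S).
    - by move=> t; rewrite mem_enum; exact: (subsetP A2S).
  by apply: contraNneq => ->; rewrite /pluck coef0 mulr0 if_same.
- exists (b1 (+) b2) => B; rewrite pE; case: ifP => _; last by rewrite rmorph0 sgz0 mulr0.
  have sg n : sgz ((-1) ^+ n : R) = (-1) ^+ n.
    by elim: n => [|n IH]; rewrite ?sgz1 // !exprS sgzM IH sgzN sgz1.
  rewrite !rmorphM rmorph_sign !sgzM sg h1 h2 signr_addb; ring.
Qed.

End Presentations.

(** * The deletion and contraction recursion *)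

Section PortedRecursion.
Variables (K L : fieldType) (phi : {rmorphism K -> L}) (T : finType).
Variables (eps : seq T -> int) (g r : T -> L).
Hypothesis eps_go : ground_orientation eps.
Implicit Types (N : ext K T).

Let eps1_sq e : eps [:: e] * eps [:: e] = 1.
Proof. by apply: eps_sq. Qed.

Lemma set_seq1 (e : T) : [set t in [:: e]] = [set e].
Proof. by apply/setP => t; rewrite !inE. Qed.

Lemma over_set1 (x : ext K T) e : over [set e] x ->
  x = coef x set0 *: 1 + coef x [set e] *: gen K e.
Proof.
move=> ox; apply/extP => A; rewrite coefD !coefZ !coef_base.
have ne : (set0 == [set e]) = false by apply/negbTE/eqP => /setP /(_ e); rewrite !inE eqxx.
have [|nA] := boolP (A \subset [set e]).
  rewrite subset1 => /orP[]/eqP ->; rewrite eqxx ?ne ?(eq_sym _ set0) ?ne;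
    by rewrite ?(mulr0, mulr1, add0r, addr0).
rewrite ox //; case: eqP nA => [->|_]; first by rewrite sub0set.
by case: eqP => [->|_]; rewrite ?subxx // !mulr0 addr0.
Qed.

(** By degree only the constant coefficient survives. The value of [eps] at [e] may be -1 and is
    cancelled later by the normalization. *)
Lemma dual_gen e : dual eps [set e] (gen K e) = (eps [:: e])%:~R *: 1.
Proof.
rewrite [LHS](over_set1 (@over_dual _ _ _ _ _)).
rewrite [X in _ + X *: _](homog_dual eps (S := [set e]) (@homog_gen K T e)) ?cards1 //.
rewrite scale0r addr0 -pluck_enum (pluck_dual eps_go _ (Y := [:: e])) //.
- by rewrite enum_set0 /= -(enum_set1 e) pluck_enum coef_base eqxx mul1r.
- by move=> t; rewrite mem_enum inE.
- by rewrite set_seq1 set_enum setD0.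
Qed.

Lemma dual_one e : dual eps [set e] 1 = (eps [:: e])%:~R *: gen K e.
Proof.
rewrite [LHS](over_set1 (@over_dual _ _ _ _ _)).
rewrite [X in X *: _ + _](homog_dual eps (S := [set e]) (@homog1 K T)) ?cards1 ?cards0 //.
rewrite scale0r add0r -pluck_enum (pluck_dual eps_go _ (Y := [::])) //.
- by rewrite enum_set1 /= -(enum_set0 T) pluck_enum coef_base eqxx mul1r.
- by move=> t; rewrite mem_enum inE.
- by rewrite set_enum setDv; apply/setP => t; rewrite !inE.
Qed.

Lemma normalized_ME_gen e : normalized_ME phi eps g r [::] [:: e] (gen K e) = g e *: 1.
Proof.
rewrite /normalized_ME /extensor_ME /extensor_M set_seq1 dual_gen inducedZ induced1 induced_gen.
rewrite /iotag in_nil -scalerAr mulr1 !contract_seqZ (contract_gen L (elt e)) !scalerA rmorph_int.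
by rewrite -rmorphM eps1_sq mul1r.
Qed.

Lemma normalized_ME_one e : normalized_ME phi eps g r [::] [:: e] (1 : ext K T) = r e *: 1.
Proof.
rewrite /normalized_ME /extensor_ME /extensor_M set_seq1 dual_one inducedZ induced1 induced_gen.
rewrite /upsilonr in_nil mul1r !contract_seqZ (contract_gen L (elt e)) !scalerA rmorph_int.
by rewrite -rmorphM eps1_sq mul1r.
Qed.

Lemma normalized_ME_recursion P E e N k : uniq (P ++ E) -> e \in E ->
  over [set t in P ++ E] N -> homog k N ->
  normalized_ME phi eps g r P E N =
    g e *: normalized_ME phi eps g r P (rem e E) (contract N e) +
    r e *: normalized_ME phi eps g r P (rem e E) (delete N e).
Proof.
move=> uPE eE oN hN; set E' := rem e E; set S' := [set t in P ++ E'].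
have pE : perm_eq E (E' ++ [:: e]) by rewrite perm_sym cats1 perm_rcons perm_sym perm_to_rem.
have : uniq ((P ++ E') ++ [:: e]) by rewrite -catA -(perm_uniq (_ : perm_eq (P ++ E) _)) ?perm_cat2l.
rewrite cats1 rcons_uniq => /andP[eS' uPE'].
have SE : [set t in P ++ E] = S' :|: [set e].
  by apply/setP => t; rewrite !inE !mem_cat (perm_mem pE) mem_cat inE orbA.
have SD : [set t in P ++ E] :\ e = S'.
  rewrite SE; apply/setP => t; rewrite !inE.
  by case: (t =P e) => [->|_] /=; rewrite ?orbF // (negbTE eS').
have d : [disjoint S' & [set t in [::] ++ [:: e]]].
  by rewrite set_seq1 disjoint_sym disjoints1 inE.
set N1 := contract N e; set N0 := delete N e.
have o1 : over S' N1 by rewrite -SD; exact: over_contract.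
have o0 : over S' N0 by rewrite -SD; exact: over_delete.
have h1 : homog k.-1 N1 by exact: homog_contract.
have h0 : homog k N0 by exact: homog_delete.
have og : over [set t in [::] ++ [:: e]] (gen K e) by apply: over_gen; rewrite inE mem_head.
(* Both parts of [N] are products over the same partition, with second factor [e] or 1 and no ports
   in it; these give the two terms of the right-hand side. *)
have mul1 := normalized_ME_mul phi g r eps_go uPE' (P2 := [::]) (E2 := [:: e]) isT d pE o1 og h1
  (@homog_gen K T e).
have mul0 := normalized_ME_mul phi g r eps_go uPE' (P2 := [::]) (E2 := [:: e]) isT d pE o0
  (@over1 K T _) h0 (@homog1 K T).
rewrite cats0 normalized_ME_gen -scalerAr mulr1 in mul1.
rewrite cats0 normalized_ME_one -scalerAr !mulr1 in mul0.
rewrite -mul1 -mul0 {mul1 mul0} /normalized_ME -scalerDr; congr (_ *: _).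
(* Substituting the decomposition in [N] and in its dual yields four terms. The diagonal ones are
   the wanted summands, so the two mixed ones have to vanish. *)
rewrite /extensor_ME /extensor_M {1 2}(contract_delete N e) -/N1 -/N0.
rewrite dualD (inducedD phi (iotag g P)) (inducedD phi (upsilonr r P)).
set I := induced phi (iotag g P); set U := induced phi (upsilonr r P).
have IM x y : I (x * y) = I x * I y.
  by apply: inducedM; [exact: iotag_sq|exact: iotag_anti].
have UM x y : U (x * y) = U x * U y.
  by apply: inducedM; [exact: upsilonr_sq|exact: upsilonr_anti].
have eP : e \in P = false by apply/negP => eP; rewrite mem_cat eP in eS'.
have d' : [disjoint S' & [set e]] by rewrite disjoint_sym disjoints1 inE.
(* For the mixed terms only the shape of the duals matters, so their scalars stay unspecified: the
   dual of [N0] has the factor [e], that of [N1 * gen K e] lacks it. *)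
have [s0 D0] : exists s, dual eps [set t in P ++ E] N0 = s *: (dual eps S' N0 * gen K e).
  have := dual_mul eps_go (z2 := [:: e]) d' uPE' isT erefl (esym (set_seq1 e)) o0
    (@over1 K T _) h0 (@homog1 K T).
  by rewrite mulr1 -SE dual_one -scalerAr scalerA => ->; eexists.
have [s1 D1] : exists s, dual eps [set t in P ++ E] (N1 * gen K e) = s *: dual eps S' N1.
  have oe : over [set e] (gen K e) by apply: over_gen; rewrite inE.
  have := dual_mul eps_go (z2 := [:: e]) d' uPE' isT erefl (esym (set_seq1 e)) o1
    oe h1 (@homog_gen K T e).
  by rewrite -SE dual_gen -scalerAr mulr1 scalerA => ->; eexists.
have IU : I (gen K e) * U (gen K e) = 0.
  rewrite /I /U !induced_gen /iotag /upsilonr eP.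
  by rewrite -scalerAl -scalerAr gen_sq !scaler0.
have C1 : I (N1 * gen K e) * U (dual eps [set t in P ++ E] N0) = 0.
  rewrite D0 /U inducedZ -/U UM IM -scalerAr -mulrA (mulrA (I (gen K e))).
  rewrite (iota_upsilon_comm phi g r P (@homog_gen K T e) (homog_dual eps (S := S') h0)) -/U -/I.
  by rewrite -scalerAl -(mulrA (U _)) IU !(mulr0, scaler0).
(* Neither factor contains [elt e], which is among the contracted letters. *)
have C2 : contract_seq (I N0 * U (dual eps [set t in P ++ E] (N1 * gen K e))) (map (@elt T) E) = 0.
  rewrite D1 /U inducedZ -scalerAr contract_seqZ -/U.
  have oX : over (lift_set S') (I N0 * U (dual eps S' N1)).
    apply: overM; first by apply: over_induced o0 _ => t; exact: over_iotag.
    by apply: over_induced (@over_dual _ _ _ _ _) _ => t; exact: over_upsilonr.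
  rewrite (contract_seq_notin oX (u := elt e)) ?scaler0 ?inE //.
  by apply/mapP; exists e.
rewrite mulrDl !mulrDr C1 addr0 !contract_seqD C2 add0r.
by congr (_ + _).
Qed.

End PortedRecursion.

(** * The portless case *)

Section Monomials.
Variables (F : fieldType) (T : finType).

(** By degree only the constant coefficient can survive; there the sorting sign of [X] appears once
    in the monomial and once in the coordinate. *)
Lemma contract_mon (X : seq T) : uniq X -> contract_seq (mon F X) X = 1.
Proof.
move=> uX; apply/extP => A; rewrite -pluck_enum pluck_contract_seq [RHS]coef_base.
have [->|[a aA]] := set_0Vmem A.
  rewrite enum_set0 eqxx /= /pluck uX mon_sort uX coefZ coef_base eqxx mulr1.
  by rewrite -expr2 sqrr_sign.
have hX : homog (size X) (mon F X).
  rewrite mon_sort; apply: homogZ; have -> : size X = #|[set t in X]|.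
    by rewrite cardsE (card_uniqP uX).
  exact: homog_base.
rewrite (homog_pluck hX); last first.
  by rewrite size_cat -cardE -{2}[size X]add0n eqn_add2r cards_eq0; apply/set0Pn; exists a.
by case: eqP aA => // ->; rewrite inE.
Qed.

End Monomials.

(** If [s] is not an order of [X], it either repeats a letter, and the monomial is 0, or misses one,
    and the contraction is 0. If it is, [f] absorbs the sign of the reordering. *)
Lemma contract_mon_sub (F : fieldType) (T T' : finType) (j : T -> T') (f : seq T -> F)
    (s X : seq T) :
  injective j -> alternating f -> uniq X -> {subset s <= X} ->
  f X *: contract_seq (mon F (map j s)) (map j X) = (if perm_eq s X then f s else 0) *: 1.
Proof.
move=> ij af uX sX; case: ifP => [p|/negP np].
  have us : uniq (map j s) by rewrite map_inj_uniq // (perm_uniq p).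
  by rewrite perm_sym in p; rewrite (contract_seq_perm _ ij af p) contract_mon.
rewrite scale0r mon_sort map_inj_uniq //; case: ifP => us; last first.
  by rewrite contract_seqZ scale0r scaler0.
have /allPn[u uX' us'] : ~~ all [in s] X.
  by apply/negP => /allP Xs; apply: np; apply: uniq_perm => // t; apply/idP/idP => [/sX|/Xs].
rewrite (contract_seq_notin (S := [set t in map j s]) (u := j u)) ?scaler0 //.
- by apply: overZ; exact: over_base.
- by rewrite inE mem_map.
- by rewrite mem_map.
Qed.

Lemma prod_scale_gen (F : fieldType) (T T' : finType) (j : T -> T') (a : T -> F) (s : seq T) :
  \prod_(t <- s) (a t *: gen F (j t)) = (\prod_(t <- s) a t) *: mon F (map j s).
Proof.
elim: s => [|t s IH]; first by rewrite /mon !big_nil scale1r.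
by rewrite /mon map_cons !big_cons IH -scalerAl -scalerAr scalerA.
Qed.

Section NoPorts.
Variables (K L : fieldType) (phi : {rmorphism K -> L}) (T : finType).
Variables (eps : seq T -> int) (g r : T -> L).
Hypothesis eps_go : ground_orientation eps.

(** Pairs of monomials [A] from [N] and [X] from its dual survive only for [X] complementary to [A].
    The contraction then gives [eps] at [A X], the dual gives the same value again, and the
    coefficient of [N] at [A] occurs squared. *)
Lemma normalized_ME_noports (E : seq T) (N : ext K T) : uniq E -> over [set t in E] N ->
  normalized_ME phi eps g r [::] E N =
  (\sum_A phi (coef N A) ^+ 2 *
     ((\prod_(e in A) g e) * \prod_(e in [set t in E] :\: A) r e)) *: 1.
Proof.
move=> uE oN; case: (eps_go) => alt _ _; set S := [set t in E].
have altL := alternating_intr L alt.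
rewrite /normalized_ME /extensor_ME /extensor_M !inducedE /= -/S mulr_suml.
have sumC I (s : seq I) (f : I -> ext L (ported T)) X :
    contract_seq (\sum_(i <- s) f i) X = \sum_(i <- s) contract_seq (f i) X.
  apply: (big_morph (fun x => contract_seq x X)) => [x y|]; first exact: contract_seqD.
  by rewrite -{1}(scale0r 0) contract_seqZ scale0r.
rewrite sumC scaler_sumr scaler_suml; apply: eq_bigr => A _.
have [AS|/oN ->] := boolP (A \subset S); last first.
  by rewrite rmorph0 scale0r mul0r -(scale0r 0) contract_seqZ !scale0r scaler0 expr0n mul0r scale0r.
have gE : \prod_(t <- enum A) iotag g [::] t = (\prod_(e in A) g e) *: mon L (map (@elt T) (enum A)).
  by rewrite -big_enum -prod_scale_gen.
have rE (X : {set T}) : \prod_(t <- enum X) upsilonr r [::] t =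
    (\prod_(e in X) r e) *: mon L (map (@elt T) (enum X)).
  by rewrite -big_enum -prod_scale_gen.
rewrite gE mulr_sumr sumC scaler_sumr.
have key (X : {set T}) : X \subset S -> (eps E)%:~R *: contract_seq
    (phi (coef N A) *: ((\prod_(e in A) g e) *: mon L [seq elt i | i <- enum A]) *
      (phi (coef (dual eps S N) X) *: \prod_(t <- enum X) upsilonr r [::] t))
    [seq elt i | i <- E] =
   if X == S :\: A then (phi (coef N A) ^+ 2 *
     ((\prod_(e in A) g e) * \prod_(e in S :\: A) r e)) *: 1 else 0.
  move=> XS; rewrite rE -!scalerAl -!scalerAr !scalerA.
  have -> : mon L [seq elt i | i <- enum A] * mon L [seq elt i | i <- enum X] =
      mon L (map (@elt T) (enum A ++ enum X)) by rewrite /mon map_cat big_cat.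
  have cm := contract_mon_sub (s := enum A ++ enum X) (@elt_inj T) altL uE.
  rewrite contract_seqZ scalerA [(eps E)%:~R * _]mulrC -(scalerA _ (eps E)%:~R) {}cm; last first.
    by move=> t; rewrite mem_cat !mem_enum => /orP[/(subsetP AS)|/(subsetP XS)]; rewrite inE.
  (* An order of [E] has no repetition, so [A] and [X] are disjoint and cover the ground set. *)
  have -> : perm_eq (enum A ++ enum X) E = (X == S :\: A).
    apply/idP/eqP => [p|->].
      have : uniq (enum A ++ enum X) by rewrite (perm_uniq p).
      rewrite cat_uniq => /and3P[_ /hasPn AX _].
      apply/setP => t; have := perm_mem p t; rewrite mem_cat !mem_enum !inE => <-.
      have := AX t; rewrite /= !mem_enum; case: (t \in X); case: (t \in A) => //=.
      by move=> /(_ isT).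
    apply: uniq_perm => //.
      rewrite cat_uniq !enum_uniq andbT; apply/hasPn => t; rewrite !mem_enum inE.
      by case/andP.
    move=> t; rewrite mem_cat !mem_enum !inE; case tA: (t \in A) => //=.
    by have := subsetP AS t tA; rewrite inE => ->.
  case: eqP => [->|_]; last by rewrite scale0r scaler0.
  rewrite -[coef (dual _ _ _) _]pluck_enum (pluck_dual eps_go _ (Y := enum A)) ?enum_uniq //; first last.
  - by rewrite !set_enum setDDr setDv set0U (setIidPr AS).
  - by move=> t; rewrite mem_enum inE => /andP[].
  rewrite pluck_enum rmorphM rmorph_int scalerA; congr (_ *: _).
  set z := eps _; have zz : z%:~R * z%:~R = 1 :> L.
    rewrite -rmorphM eps_sq //= cat_uniq !enum_uniq andbT; apply/hasPn => t.
    by rewrite !mem_enum inE; case/andP.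
  set b := \prod_(e in A) g e; set c := \prod_(e in _) r e; set a := phi _.
  by transitivity ((z%:~R * z%:~R) * (a * a * (b * c))); [ring|rewrite zz; ring].
rewrite (bigD1 (S :\: A)) //= key ?subsetDl // eqxx [X in _ + X]big1 ?addr0 // => X nX.
have [XS|nS] := boolP (X \subset S); first by rewrite key // (negbTE nX).
rewrite (@over_dual _ _ eps S N X nS) rmorph0 scale0r mulr0.
by rewrite -(scale0r 0) contract_seqZ !scale0r scaler0.
Qed.

End NoPorts.

(** * From normalized extensors to oriented matroids *)

Theorem theorem28 (R : realType) (PK : {pred R}) (K : subFieldType PK)
    (L : fieldType) (phi : {rmorphism K -> L}) (T : finType)
    (eps : seq T -> int) (g r : T -> L) :
  ground_orientation eps ->
  (forall (M : omat T) (P E : seq T) (e : T),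
     ported_uom K M P E -> e \in E -> ~~ loop M e -> ~~ coloop M e ->
     let E' := rem e E in
     ME phi eps g r P E M =
       (eps (P ++ E) * eps (P ++ E'))%:~R *:
         (g e *: ME phi eps g r P E' (om_contract M e) +
          r e *: ME phi eps g r P E' (om_delete M e)))
  /\
  (forall (M1 M2 : omat T) (P1 E1 P2 E2 E : seq T),
     ported_uom K M1 P1 E1 -> ported_uom K M2 P2 E2 ->
     [disjoint ground M1 & ground M2] -> perm_eq E (E1 ++ E2) ->
     ME phi eps g r (P1 ++ P2) E (om_sum M1 M2) =
       (eps (P1 ++ P2 ++ E) * eps (P1 ++ E1) * eps (P2 ++ E2))%:~R *:
         (ME phi eps g r P1 E1 M1 * ME phi eps g r P2 E2 M2))
  /\
  (forall (M : omat T) (E : seq T),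
     ported_uom K M [::] E ->
     ME phi eps g r [::] E M =
       ((eps E)%:~R *
          \sum_(B in bases M)
             (\prod_(e in B) g e) * (\prod_(e in [set x in E] :\: B) r e)) *: 1).
Proof.
move=> eps_go.
(* A value of [eps] at distinct letters is its own inverse, so the normalization can be undone. *)
have denorm P E (x : ext K T) : uniq (P ++ E) ->
    extensor_ME phi eps g r P E x = (eps (P ++ E))%:~R *: normalized_ME phi eps g r P E x.
  by move=> u; rewrite scalerA -rmorphM eps_sq // rmorph1 scale1r.
split; [|split].
- move=> M P E e [[_ [N [pN uN]]] uPE gM] eE nl nc /=; have [eN _ _] := pN.
  have [pc uc] := presents_contract nl pN uN; have [pd ud] := presents_delete nc pN uN.
  rewrite (ME_presentation _ _ _ _ _ _ pN uN) (ME_presentation _ _ _ _ _ _ pc uc).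
  rewrite (ME_presentation _ _ _ _ _ _ pd ud).
  have [k hk] := homog_extensor eN; have oN := over_extensor eN; rewrite gM in oN.
  rewrite denorm // (normalized_ME_recursion phi g r eps_go uPE eE oN hk) /normalized_ME.
  by rewrite !scalerA !(mulrC _ (eps _)%:~R) -!scalerA -scalerDr scalerA rmorphM.
- move=> M1 M2 P1 E1 P2 E2 E [[_ [N1 [p1 u1]]] uPE1 g1] [[_ [N2 [p2 u2]]] uPE2 g2] d pE.
  have [ps us] := presents_sum d p1 u1 p2 u2; have [e1 _ _] := p1; have [e2 _ _] := p2.
  rewrite (ME_presentation _ _ _ _ _ _ ps us) (ME_presentation _ _ _ _ _ _ p1 u1).
  rewrite (ME_presentation _ _ _ _ _ _ p2 u2).
  have [k hk] := homog_extensor e1; have [l hl] := homog_extensor e2.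
  have o1 := over_extensor e1; have o2 := over_extensor e2.
  rewrite g1 in o1 d; rewrite g2 in o2 d.
  have uPE : uniq ((P1 ++ P2) ++ E).
    have -> : uniq ((P1 ++ P2) ++ E) = uniq ((P1 ++ E1) ++ (P2 ++ E2)).
      apply: perm_uniq; apply: (@perm_trans _ (P1 ++ P2 ++ E1 ++ E2)).
        by rewrite -catA !perm_cat2l.
      by rewrite -catA perm_cat2l perm_catCA.
    rewrite cat_uniq uPE1 uPE2 andbT; apply/hasPn => t t2; apply/negP => t1.
    by move/disjoint_setI0/setP/(_ t): d; rewrite in_setI !inE t2 /= t1.
  rewrite denorm // (normalized_ME_mul phi g r eps_go uPE1 uPE2 d pE o1 o2 hk hl) /normalized_ME.
  by rewrite -scalerAl -scalerAr !scalerA -catA !rmorphM.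
move=> M E [[_ [N [pN uN]]] uE gM]; have [eN _ [b h]] := pN.
rewrite (ME_presentation _ _ _ _ _ _ pN uN) denorm //.
have oN := over_extensor eN; rewrite gM in oN.
rewrite normalized_ME_noports // scalerA; congr (_ * _ *: _).
rewrite [RHS]big_mkcond; apply: eq_bigr => A _.
(* Unimodularity makes the square of each coefficient 1 on bases and 0 elsewhere, so the sum over
   all subsets becomes the sum over bases. *)
rewrite inE (presents_chi0 _ pN) pluck_enum; have := uN (enum A); rewrite pluck_enum !inE.
by case/or3P => /eqP ->; rewrite ?eqxx ?oppr_eq0 ?oner_eq0 /=
  ?rmorphN ?rmorph0 ?rmorph1 ?sqrrN ?expr1n ?expr0n ?mul0r ?mul1r.
Qed.
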